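(* Let $r\geq 8$ and let $m\geq 0$ be an integer. Then $\dim \mathcal{L}_3(2m;m^r)=m$, where $m^r$ means that all $r$ multiplicities are equal to $m$.
   Context: The ground field is algebraically closed of characteristic $0$. Let $Q\subset\mathbb{P}^3$ be a smooth quadric and $B\in|-K_Q|$ a general anticanonical curve, i.e. $B$ is a smooth elliptic quartic curve. Let $p_1,\ldots,p_r$ be points in general position on $B$. For non-negative integers $m_1,\ldots,m_r$, $\mathcal{L}_3(d;m_1,\ldots,m_r)$ denotes the linear system of surfaces of degree $d$ in $\mathbb{P}^3$ having multiplicity at least $m_i$ at $p_i$ for each $i=1,\ldots,r$; $\dim$ denotes its projective dimension (vector space dimension of the corresponding space of forms minus $1$). *)

(* Defs.v *)
From HB Require Import structures.
From mathcomp Require Import all_boot all_order all_algebra.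
From mathcomp Require Export mpoly.

Set Implicit Arguments.
Unset Strict Implicit.
Unset Printing Implicit Defensive.

Import GRing.Theory.

Local Open Scope ring_scope.

(* A point of P^n is given by homogeneous coordinates, i.e. by a nonzero row
   vector in 'rV[K]_n.+1; an r-tuple of points of P^n is given by an
   r x (n+1) matrix all of whose rows are nonzero. *)

Section Smooth.
Variables (K : fieldType) (n c : nat).
Implicit Types (f : c.-tuple {mpoly K[n.+1]}) (v : 'rV[K]_n.+1).

Definition vanishes_at f v : Prop := forall i : 'I_c, (tnth f i).@[v 0] = 0.

Definition on_locus f v : Prop := v != 0 /\ vanishes_at f v.

Definition jacobian f v : 'M[K]_(c, n.+1) :=
  \matrix_(i, j) ((tnth f i)^`M(j)).@[v 0].

(* The closed subscheme of P^n defined by c forms is smooth of codimension c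
   (Jacobian criterion at every closed point; K is algebraically closed
   wherever this is used). *)
Definition smooth_complete_intersection f : Prop :=
  forall v, on_locus f v -> row_free (jacobian f v).
End Smooth.

Section GeneralPosition.
Variables (K : fieldType) (n r : nat).
Implicit Types (P : 'M[K]_(r, n.+1)) (G : {mpoly K[r * n.+1]}).

(* The homogeneous coordinates of (P^n)^r are the r * n.+1 entries of P; the
   j-th coordinate of the i-th point is the variable mxvec_index i j. *)
Definition meval_pts G P : K := G.@[mxvec P 0].

Definition multihomogeneous G : Prop :=
  exists e : 'I_r -> nat, forall mu, mu \in msupp G ->
    forall i, (\sum_(j < n.+1) mu (mxvec_index i j))%N = e i.

Definition projective_pts P : Prop := forall i, row i P != 0.

(* Zariski-open subsets of (P^n)^r: complements of common zero loci of
   arbitrary families of multihomogeneous forms. *)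
Definition zariski_open (U : 'M[K]_(r, n.+1) -> Prop) : Prop :=
  exists2 S : {mpoly K[r * n.+1]} -> Prop,
    (forall G, S G -> multihomogeneous G) &
    forall P, projective_pts P -> (U P <-> exists2 G, S G & meval_pts G P != 0).

(* A property holds for r points in general position on X, a subset of P^n,
   when it holds on a dense open subset of X^r. *)
Definition in_general_position (X : 'rV[K]_n.+1 -> Prop)
    (prop : 'M[K]_(r, n.+1) -> Prop) : Prop :=
  let Xr P := forall i, row i P != 0 /\ X (row i P) in
  exists U : 'M[K]_(r, n.+1) -> Prop,
    [/\ zariski_open U,
        forall V, zariski_open V -> (exists2 P, Xr P & V P) ->
          exists P, [/\ Xr P, U P & V P]
      & forall P, Xr P -> U P -> prop P].
End GeneralPosition.

Section LinearSystem.
Variables (K : fieldType) (n : nat).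
Implicit Types (v : 'rV[K]_n.+1) (F : {mpoly K[n.+1]}).

(* The Taylor expansion F(v + X) of F at v. *)
Definition taylor v F : {mpoly K[n.+1]} :=
  F \mPo [tuple 'X_j + (v 0 j)%:MP | j < n.+1].

(* Multiplicity at least k at the point [v].  For a form F, the order of
   vanishing of F at the vector v of the affine cone is that of any
   dehomogenization of F at the point [v]. *)
Definition mult_ge v k F : Prop :=
  forall mu : 'X_{1..n.+1}, (mdeg mu < k)%N -> (taylor v F)@_mu = 0.

Definition low_taylor d v k (F : dhomog n.+1 K d) :
    {ffun 'X_{1..n.+1 < k} -> K^o} :=
  [ffun mu : 'X_{1..n.+1 < k} => (taylor v F)@_mu].

Lemma low_taylor_is_linear d v k : linear (@low_taylor d v k).
Proof.
move=> a F G; apply/ffunP=> mu; rewrite !ffunE /taylor /=.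
by rewrite comp_mpolyD comp_mpolyZ mcoeffD mcoeffZ.
Qed.

HB.instance Definition _ d v k :=
  GRing.isLinear.Build K (dhomog n.+1 K d) {ffun 'X_{1..n.+1 < k} -> K^o} _
    (@low_taylor d v k) (low_taylor_is_linear v k).

(* The vector space of forms of degree d having multiplicity at least m i at
   the i-th point of P; see linear_systemP. *)
Definition linear_system r d (m : 'I_r -> nat) (P : 'M[K]_(r, n.+1)) :
    {vspace dhomog n.+1 K d} :=
  (\bigcap_(i < r) lker (linfun (@low_taylor d (row i P) (m i))))%VS.

Lemma linear_systemP r d (m : 'I_r -> nat) (P : 'M[K]_(r, n.+1))
    (F : dhomog n.+1 K d) :
  F \in linear_system d m P <-> forall i, mult_ge (row i P) (m i) F.
Proof.
rewrite /linear_system; split.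
  move=> FL i mu lt_mu; move: FL; rewrite memvE => /subv_bigcapP/(_ i isT).
  rewrite -memvE memv_ker lfunE => /eqP/ffunP/(_ (BMultinom lt_mu)).
  by rewrite !ffunE.
move=> Fm; rewrite memvE; apply/subv_bigcapP=> i _.
rewrite -memvE memv_ker lfunE; apply/eqP/ffunP=> mu.
by rewrite !ffunE Fm ?bmdeg.
Qed.

(* Projective dimension, equal to -1 for an empty linear system. *)
Definition pdim d (L : {vspace dhomog n.+1 K d}) : int := (\dim L)%:Z - 1.
End LinearSystem.

(* Main.v *)
(* Simultaneous diagonalization of the pencil spanned by the two quadrics brings
   the curve B to the shape u^2 = f(t), w^2 = g(t), where f and g are squarefree
   quadratic polynomials without common root.  Its coordinate ring is then free
   over K[x0, x1] with basis 1, x2, x3, x2 x3.  Hence the forms of degree 2k span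
   a space of dimension at most 8k on B, those vanishing on B lie in the ideal of
   the two quadrics, and B is irreducible because the norm to K[t] of a nonzero
   element is nonzero.

   In characteristic 0 the Wronskian, taken along a vector field tangent to B, of
   linearly independent functions does not vanish.  So each new general point of
   B imposes min(k, n) conditions of vanishing to order k on a system of dimension
   n, and after 8 general points a form of degree 2k that vanishes to order k at
   each of them vanishes on B.

   If F has degree 2m and multiplicity m at the points and lies in the j-th power
   of the ideal of B, then differentiating j times transversally to B shows that
   the coefficients of F in that power have contact of order m - j with B at the
   points.  They have degree 2(m - j), so they vanish on B and F lies in the next
   power.  For j = m this leaves the m + 1 monomials of degree m in the two
   quadrics, which always belong to the system. *)

Require Import Defs.
From HB Require Import structures.
From mathcomp Require Import all_boot all_order all_algebra.
From mathcomp Require Import perm ring zify.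

Set Implicit Arguments.
Unset Strict Implicit.
Unset Printing Implicit Defensive.

Import GRing.Theory.

Local Open Scope ring_scope.

(** Identities between ring morphisms and derivations reduce in this way to constants and
    variables. *)
Lemma mpoly_ring_ind (R : comNzRingType) n (P : {mpoly R[n]} -> Prop) :
  (forall c, P c%:MP) -> (forall i, P 'X_i) ->
  (forall F G, P F -> P G -> P (F + G)) ->
  (forall F G, P F -> P G -> P (F * G)) -> forall F, P F.
Proof.
move=> PC PX PD PM; elim/mpolyind => [|c m F _ _ PF]; first by rewrite -mpolyC0.
apply: (PD) => //; rewrite -mul_mpolyC; apply: (PM) => //.
rewrite mpolyXE_id; elim/big_ind: _ => // [|i _]; first by rewrite -mpolyC1.
by elim: (m i) => [|k IH]; rewrite ?expr0 -?mpolyC1 // exprS; apply: (PM).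
Qed.

(** * Multiplicity and linear substitutions *)

Section Monomials.
Variable n : nat.
Implicit Type m : 'X_{1..n}.

Lemma submm m : (m - m = 0)%MM.
Proof. by apply/mnmP => i; rewrite mnmBE subnn mnm0E. Qed.

Lemma mnm_neq0P m : m != 0%MM -> exists i, m i != 0%N.
Proof.
move=> m0; apply/existsP; apply: contraNT m0 => /existsPn m0.
by apply/eqP/mnmP => i; rewrite mnm0E; apply/eqP; rewrite -[_ == _]negbK m0.
Qed.

End Monomials.

Section Multiplicity.
Variables (K : fieldType) (n : nat).
Implicit Types (v : 'rV[K]_n.+1) (F G : {mpoly K[n.+1]}).

Lemma taylorD v F G : taylor v (F + G) = taylor v F + taylor v G.
Proof. exact: comp_mpolyD. Qed.

Lemma taylorM v F G : taylor v (F * G) = taylor v F * taylor v G.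
Proof. exact: rmorphM. Qed.

Lemma taylorC v c : taylor v c%:MP = c%:MP.
Proof. exact: comp_mpolyC. Qed.

Lemma taylorX v j : taylor v 'X_j = 'X_j + (v 0 j)%:MP.
Proof. by rewrite /taylor comp_mpolyXU -tnth_nth tnth_mktuple. Qed.

Lemma meval0_mcoeff F : F.@[fun=> 0] = F@_0.
Proof.
elim/mpolyind: F => [|c m F _ _ IH]; first by rewrite meval0 mcoeff0.
rewrite mevalD mcoeffD IH mevalZ mcoeffZ mevalX mcoeffX; congr (_ * _ + _).
have [->|m0] := eqVneq m 0%MM.
  by rewrite big1 // => i _; rewrite mnm0E expr0.
have [i mi] := mnm_neq0P m0.
by rewrite (bigD1 i) //= expr0n (negPf mi) mul0r.
Qed.

Lemma taylor_mcoeff0 v F : (taylor v F)@_0 = F.@[v 0].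
Proof.
rewrite -meval0_mcoeff comp_mpoly_meval; apply: meval_eq => j.
by rewrite tnth_mktuple mevalD mevalXU mevalC add0r.
Qed.

Lemma taylor_mderiv v j F : taylor v F^`M(j) = (taylor v F)^`M(j).
Proof.
elim/mpoly_ring_ind: F => [c|i|F G IF IG|F G IF IG].
- by rewrite taylorC !mderivC -mpolyC0 taylorC.
- rewrite taylorX mderivD mderivC addr0 !mderivX mnm1E.
  case: eqP => [->|_]; last by rewrite !scale0r -mpolyC0 taylorC.
  by rewrite !scale1r !submm mpolyX0 -mpolyC1 taylorC.
- by rewrite mderivD !taylorD mderivD IF IG.
- by rewrite mderivM !(taylorM, taylorD) mderivM IF IG.
Qed.

Lemma mult_geD v k F G : mult_ge v k F -> mult_ge v k G -> mult_ge v k (F + G).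
Proof. by move=> vF vG mu lt_mu; rewrite taylorD mcoeffD vF ?vG ?addr0. Qed.

Lemma mult_geM v k l F G :
  mult_ge v k F -> mult_ge v l G -> mult_ge v (k + l) (F * G).
Proof.
move=> vF vG mu lt_mu; rewrite taylorM mcoeffM big1 // => -[m1 m2] /=.
move=> /eqP Emu; case: (ltnP (mdeg m1) k) => [/vF->|le1]; first by rewrite mul0r.
rewrite vG ?mulr0 //; rewrite ltnNge; apply: contraL lt_mu => le2.
by rewrite -leqNgt [X in (_ <= mdeg X)%N]Emu mdegD leq_add.
Qed.

Lemma mult_ge0 v F : mult_ge v 0 F.
Proof. by []. Qed.

Lemma mult_ge_mull v k F G : mult_ge v k G -> mult_ge v k (F * G).
Proof. exact: (mult_geM (mult_ge0 v F)). Qed.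

Lemma mult_ge1 v F : mult_ge v 1 F <-> F.@[v 0] = 0.
Proof.
split=> [/(_ 0%MM)|F0 mu]; first by rewrite mdeg0 taylor_mcoeff0; apply.
by rewrite ltnS leqn0 mdeg_eq0 => /eqP->; rewrite taylor_mcoeff0.
Qed.

Lemma mult_geW v k l F : (l <= k)%N -> mult_ge v k F -> mult_ge v l F.
Proof. by move=> le_lk vF mu lt_mu; apply/vF/(leq_trans lt_mu). Qed.

Lemma mult_ge_mderiv v k j F : mult_ge v k.+1 F -> mult_ge v k F^`M(j).
Proof.
move=> vF mu lt_mu; rewrite taylor_mderiv mcoeff_deriv vF ?mul0rn //.
by rewrite mdegD mdeg1 addn1 ltnS.
Qed.

Lemma mult_ge_exp v F e : F.@[v 0] = 0 -> mult_ge v e (F ^+ e).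
Proof.
move=> F0; elim: e => [|e IH]; first exact: mult_ge0.
by rewrite exprS -add1n; apply: mult_geM => //; apply/mult_ge1.
Qed.

Definition lin_subst (M : 'M[K]_n.+1) F : {mpoly K[n.+1]} :=
  F \mPo [tuple \sum_i M i j *: 'X_i | j < n.+1].

Lemma lin_substM M F G : lin_subst M (F * G) = lin_subst M F * lin_subst M G.
Proof. exact: rmorphM. Qed.

Lemma lin_substXn M F k : lin_subst M (F ^+ k) = lin_subst M F ^+ k.
Proof. exact: rmorphXn. Qed.

Lemma lin_substD M F G : lin_subst M (F + G) = lin_subst M F + lin_subst M G.
Proof. exact: comp_mpolyD. Qed.

Lemma lin_substC M c : lin_subst M c%:MP = c%:MP.
Proof. exact: comp_mpolyC. Qed.

Lemma lin_substZ M c F : lin_subst M (c *: F) = c *: lin_subst M F.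
Proof. exact: comp_mpolyZ. Qed.

Lemma lin_substX M j : lin_subst M 'X_j = \sum_i M i j *: 'X_i.
Proof. by rewrite /lin_subst comp_mpolyXU -tnth_nth tnth_mktuple. Qed.

Lemma lin_subst_sum M (I : Type) (s : seq I) (P : pred I) (f : I -> {mpoly K[n.+1]}) :
  lin_subst M (\sum_(i <- s | P i) f i) = \sum_(i <- s | P i) lin_subst M (f i).
Proof. exact: raddf_sum. Qed.

Lemma meval_lin_subst M F v : (lin_subst M F).@[v 0] = F.@[(v *m M) 0].
Proof.
rewrite comp_mpoly_meval; apply: meval_eq => j.
rewrite tnth_mktuple raddf_sum mxE; apply: eq_bigr => i _.
by rewrite /= mevalZ mevalXU mulrC.
Qed.

Lemma lin_subst_mul M N F : lin_subst M (lin_subst N F) = lin_subst (M *m N) F.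
Proof.
elim/mpoly_ring_ind: F => [c|j|F G IF IG|F G IF IG].
- by rewrite !lin_substC.
- rewrite !lin_substX lin_subst_sum.
  under eq_bigr do rewrite lin_substZ lin_substX scaler_sumr.
  rewrite exchange_big; apply: eq_bigr => i _ /=.
  rewrite mxE scaler_suml; apply: eq_bigr => l _.
  by rewrite scalerA mulrC.
- by rewrite !lin_substD IF IG.
- by rewrite !lin_substM IF IG.
Qed.

Lemma lin_subst1 F : lin_subst 1%:M F = F.
Proof.
rewrite -[RHS]comp_mpoly_id /lin_subst; congr comp_mpoly.
apply: eq_mktuple => j; rewrite (bigD1 j) //= mxE eqxx scale1r.
by rewrite big1 ?addr0 // => i ij; rewrite mxE (negPf ij) scale0r.
Qed.

Lemma dhomog_prodr (I : Type) (s : seq I) (P : pred I)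
    (f : I -> {mpoly K[n.+1]}) (d : I -> nat) :
  (forall i, P i -> f i \is (d i).-homog) ->
  \prod_(i <- s | P i) f i \is (\sum_(i <- s | P i) d i).-homog.
Proof.
move=> fd; elim/big_rec2: _ => [|i e F Pi He]; first exact: dhomog1.
by apply: dhomogM => //; apply: fd.
Qed.

Lemma dhomogXU (i : 'I_n.+1) : ('X_i : {mpoly K[n.+1]}) \is 1.-homog.
Proof. by rewrite dhomogX /= mdeg1. Qed.

Lemma dhomog_lin_substX M (m : 'X_{1..n.+1}) : lin_subst M 'X_[m] \is (mdeg m).-homog.
Proof.
rewrite /lin_subst comp_mpolyX mdegE; apply: dhomog_prodr => j _.
rewrite tnth_mktuple; set l := \sum_i _.
have /(dhomogMn (m j)) : l \is 1.-homog; last by rewrite mul1n.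
by apply: rpred_sum => i _; apply: dhomogZ; apply: dhomogXU.
Qed.

Lemma dhomog_lin_subst M d F : F \is d.-homog -> lin_subst M F \is d.-homog.
Proof.
move=> /dhomogP Fd; rewrite [F]mpolyE lin_subst_sum big_seq.
apply: rpred_sum => m /Fd <-; rewrite lin_substZ; apply: dhomogZ.
exact: dhomog_lin_substX.
Qed.

Lemma taylor_lin_subst M v F : taylor v (lin_subst M F) = lin_subst M (taylor (v *m M) F).
Proof.
elim/mpoly_ring_ind: F => [c|j|F G IF IG|F G IF IG].
- by rewrite taylorC !lin_substC taylorC.
- rewrite taylorX lin_substD !lin_substX lin_substC [taylor v _]raddf_sum /=.
  under eq_bigr do rewrite comp_mpolyZ -/(taylor v _) taylorX scalerDr.
  rewrite big_split; congr (_ + _); rewrite mxE raddf_sum; apply: eq_bigr => i _.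
  by rewrite /= mulrC mpolyCM mul_mpolyC.
- by rewrite !(lin_substD, taylorD) IF IG.
- by rewrite !(lin_substM, taylorM) IF IG.
Qed.

(** Taylor expansion commutes with the substitution once the base point is moved, and a linear
    substitution sends each monomial to a form of the same degree, so no term of low order
    appears. *)
Lemma mult_ge_lin_subst M v k F : mult_ge (v *m M) k F -> mult_ge v k (lin_subst M F).
Proof.
move=> vF mu lt_mu; rewrite taylor_lin_subst; set G := taylor _ _.
rewrite [G]mpolyE lin_subst_sum raddf_sum big1 //= => m _.
rewrite lin_substZ mcoeffZ; case: (ltnP (mdeg m) k) => [/vF->|le_m].
  by rewrite mul0r.
rewrite (dhomog_nemf_coeff (dhomog_lin_substX M m)) ?mulr0 //=.
by rewrite neq_ltn (leq_trans lt_mu).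
Qed.

End Multiplicity.

(** * Normal forms modulo the two quadrics *)

Notation o0 := (@Ordinal 4 0 isT).
Notation o1 := (@Ordinal 4 1 isT).
Notation o2 := (@Ordinal 4 2 isT).
Notation o3 := (@Ordinal 4 3 isT).

Lemma ord4_ind (P : 'I_4 -> Prop) : P o0 -> P o1 -> P o2 -> P o3 -> forall i, P i.
Proof.
by move=> P0 P1 P2 P3 [[|[|[|[|//]]]] lt_i4];
  [move: P0|move: P1|move: P2|move: P3]; rewrite (bool_irrelevance isT lt_i4).
Qed.

Section QuadricNormalForms.
Variable K : fieldType.
Variables (al be ga de : K).

Local Notation A := {mpoly K[4]}.
Local Notation X0 := ('X_o0 : A).
Local Notation X1 := ('X_o1 : A).
Local Notation X2 := ('X_o2 : A).
Local Notation X3 := ('X_o3 : A).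

(** The diagonal pencil, solved for the squares of [X2] and [X3]. In the chart X0 = 1 the curve is a
    biquadratic cover of the t-line. *)
Definition q1 : A := X2 ^+ 2 - (al *: X0 ^+ 2 + be *: X1 ^+ 2).
Definition q2 : A := X3 ^+ 2 - (ga *: X0 ^+ 2 + de *: X1 ^+ 2).

(* The homogenization of [a] in degree [n - 1], for [size a <= n]. *)
Definition bform n (a : {poly K}) : A :=
  \sum_(j < n) a`_j *: (X0 ^+ (n.-1 - j) * X1 ^+ j).

Lemma bform0 a : bform 0 a = 0.
Proof. by rewrite /bform big_ord0. Qed.

Lemma bformD n a b : bform n (a + b) = bform n a + bform n b.
Proof. by rewrite -big_split; apply: eq_bigr => j _; rewrite coefD scalerDl. Qed.

Lemma bformZ n c a : bform n (c *: a) = c *: bform n a.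
Proof. by rewrite scaler_sumr; apply: eq_bigr => j _; rewrite coefZ scalerA. Qed.

Lemma bform_poly0 n : bform n 0 = 0.
Proof. by rewrite /bform big1 // => j _; rewrite coef0 scale0r. Qed.

Lemma bform_mulX0 n (a : {poly K}) : (size a <= n)%N -> bform n a * X0 = bform n.+1 a.
Proof.
move=> sz_a; rewrite [RHS]big_ord_recr /= nth_default // scale0r addr0.
rewrite mulr_suml; apply: eq_bigr => j _ /=.
rewrite -scalerAl mulrAC -exprSr; congr (_ *: (_ ^+ _ * _)).
by have := ltn_ord j; lia.
Qed.

Lemma bform_mulX1 n (a : {poly K}) : bform n a * X1 = bform n.+1 (a * 'X).
Proof.
rewrite [RHS]big_ord_recl coefMX /= scale0r add0r.
rewrite mulr_suml; apply: eq_bigr => j _ /=.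
rewrite /bump add1n -scalerAl -mulrA -exprSr coefMX /=; congr (_ *: (_ ^+ _ * _)).
by have := ltn_ord j; lia.
Qed.

Lemma size_mulX_leq (n : nat) (a : {poly K}) :
  (size a <= n)%N -> (size (a * 'X)%R <= n.+1)%N.
Proof.
move=> sz_a; have [->|a0] := eqVneq a 0; first by rewrite mul0r size_poly0.
by rewrite size_mulX.
Qed.

Lemma bform_mul_quadric n (a : {poly K}) x y : (size a <= n)%N ->
  bform n a * (x *: X0 ^+ 2 + y *: X1 ^+ 2) = bform n.+2 (x *: a + y *: (a * 'X * 'X)).
Proof.
move=> sz_a; rewrite mulrDr -!scalerAr !expr2 !mulrA bformD !bformZ.
by rewrite bform_mulX0 // bform_mulX0 ?leqW // !bform_mulX1.
Qed.

Lemma size_mul_quadric n (a : {poly K}) x y : (size a <= n)%N ->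
  (size (x *: a + y *: (a * 'X * 'X))%R <= n.+2)%N.
Proof.
move=> sz_a; rewrite (leq_trans (size_polyD _ _)) // geq_max.
rewrite (leq_trans (size_scale_leq _ _)) ?(leq_trans (size_scale_leq _ _)) //.
  by do 2!apply: size_mulX_leq.
by do 2!apply: leqW.
Qed.

Lemma dhomogXn (i : 'I_4) k : ('X_i ^+ k : A) \is k.-homog.
Proof. by have := dhomogMn k (dhomogXU K i); rewrite mul1n. Qed.

Lemma dhomog_bform n a : bform n.+1 a \is n.-homog.
Proof.
apply: rpred_sum => j _; apply: dhomogZ => /=.
have := dhomogM (dhomogXn o0 (n - j)) (dhomogXn o1 j).
by rewrite subnK // -ltnS.
Qed.

(* [cohomog d G] says that [G] has degree [d - 2], the subtraction being genuine:
   for [d < 2] it says [G = 0]. *)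
Definition cohomog d (G : A) : bool :=
  if d is d'.+2 then G \is d'.-homog else G == 0.

Lemma cohomogX d G i : cohomog d G -> cohomog d.+1 (G * 'X_i).
Proof.
case: d => [|[|d]] /= GH; rewrite ?(eqP GH) ?mul0r ?eqxx ?rpred0 //.
by have := dhomogM GH (dhomogXU K i); rewrite addn1.
Qed.

Lemma cohomogD d G H : cohomog d G -> cohomog d H -> cohomog d (G + H).
Proof.
by case: d => [|[|d]] /= => [/eqP-> /eqP->|/eqP-> /eqP->|]; rewrite ?addr0 //;
  apply: rpredD.
Qed.

Lemma cohomogZ d c G : cohomog d G -> cohomog d (c *: G).
Proof.
by case: d => [|[|d]] /= => [/eqP->|/eqP->|]; rewrite ?scaler0 //; apply: dhomogZ.
Qed.

Lemma cohomog0 d : cohomog d 0.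
Proof. by case: d => [|[|d]] //=; apply: rpred0. Qed.

Lemma cohomog_bform d a : cohomog d.+1 (bform d a).
Proof. by case: d => [|d] /=; rewrite ?bform0 // dhomog_bform. Qed.

Lemma cohomog_bformX d a i : cohomog d.+1 (bform d.-1 a * 'X_i).
Proof.
case: d => [|d] /=; first by rewrite bform0 mul0r.
case: d => [|d]; first by rewrite bform0 mul0r rpred0.
by have := dhomogM (dhomog_bform d a) (dhomogXU K i); rewrite addn1.
Qed.

(** Remainder modulo [q1] and [q2] in the basis 1, X2, X3, X2 X3 over K[X0, X1], stored
    dehomogenized. The sizes bound the degrees by d, d - 1, d - 1 and d - 2; the truncations give
    zero where these are negative. *)
Definition has_nf d (F : A) : Prop := exists a b c e : {poly K}, exists G H : A,
  [/\ (size a <= d.+1)%N, (size b <= d)%N, (size c <= d)%N & (size e <= d.-1)%N] /\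
  [/\ cohomog d G, cohomog d H &
    F = bform d.+1 a + bform d b * X2 + bform d c * X3 + bform d.-1 e * (X2 * X3)
        + q1 * G + q2 * H].

Lemma has_nf0 d : has_nf d 0.
Proof.
exists 0, 0, 0, 0, 0, 0; rewrite !size_poly0; split; split; rewrite ?cohomog0 //.
by rewrite !bform_poly0 !mul0r !mulr0 !addr0.
Qed.

Lemma has_nfD d F F' : has_nf d F -> has_nf d F' -> has_nf d (F + F').
Proof.
move=> [a [b [c [e [G [H [[sa sb sc se] [cG cH ->]]]]]]]].
move=> [a' [b' [c' [e' [G' [H' [[sa' sb' sc' se'] [cG' cH' ->]]]]]]]].
have sD n (p p' : {poly K}) : (size p <= n -> size p' <= n -> size (p + p')%R <= n)%N.
  by move=> sp sp'; rewrite (leq_trans (size_polyD _ _)) // geq_max sp.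
exists (a + a'), (b + b'), (c + c'), (e + e'), (G + G'), (H + H').
rewrite !sD // !cohomogD // !bformD; split; split => //; ring.
Qed.

Lemma has_nfZ d x F : has_nf d F -> has_nf d (x *: F).
Proof.
move=> [a [b [c [e [G [H [[sa sb sc se] [cG cH ->]]]]]]]].
have sZ n (p : {poly K}) : (size p <= n -> size (x *: p) <= n)%N.
  by move=> sp; rewrite (leq_trans (size_scale_leq _ _)).
exists (x *: a), (x *: b), (x *: c), (x *: e), (x *: G), (x *: H).
rewrite !sZ // !cohomogZ // !bformZ; split; split => //.
by rewrite -!mul_mpolyC; ring.
Qed.

(** Multiplying by X2 or X3 permutes the basis, up to rewriting the square of that variable as a
    quadric in X0 and X1; the multiples of [q1] and [q2] so created go into [G] and [H]. *)
Lemma has_nfX d F i : has_nf d F -> has_nf d.+1 (F * 'X_i).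
Proof.
move=> [a [b [c [e [G [H [[sa sb sc se] [cG cH ->]]]]]]]].
(* For [d = 0] the truncated index [d.-1] breaks the degree shifts, but then [e = 0]. The next
   assertions state the shifts for [e] uniformly in [d]. *)
have e0 : d = 0%N -> e = 0.
  by move=> d0; apply/eqP; rewrite -size_poly_leq0; move: se; rewrite d0.
have hdE : bform d.-1.+1 e = bform d e.
  by case: d e0 {a b c sa sb sc se G H cG cH} => // /(_ erefl) ->; rewrite !bform_poly0.
have sdE x y : (size (x *: e + y *: (e * 'X * 'X))%R <= d.+1)%N.
  case: d e0 se {a b c sa sb sc G H cG cH hdE} => [->//|d _] se.
    by rewrite !mul0r !scaler0 addr0 size_poly0.
  exact: size_mul_quadric.
have hdQ x y :
    bform d.-1 e * (x *: X0 ^+ 2 + y *: X1 ^+ 2) = bform d.+1 (x *: e + y *: (e * 'X * 'X)).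
  case: d e0 se {a b c sa sb sc G H cG cH hdE sdE} => [->//|d _] se.
    by rewrite bform0 !mul0r !scaler0 addr0 bform_poly0.
  exact: bform_mul_quadric.
have hdX : bform d.-1 e * X1 = bform d (e * 'X).
  case: d e0 {a b c sa sb sc se G H cG cH hdE sdE hdQ} => [->//|d _];
    last exact: bform_mulX1.
  by rewrite !bform0 mul0r.
have sdX : (size (e * 'X)%R <= d)%N.
  case: d e0 se {a b c sa sb sc G H cG cH hdE sdE hdQ hdX} => [->//|d _] se.
    by rewrite mul0r size_poly0.
  exact: size_mulX_leq.
elim/ord4_ind: i.
- exists a, b, c, e, (G * X0), (H * X0); rewrite !cohomogX //.
  split; split=> //=; try exact: leqW.
  - by case: d se {sa sb sc cG cH e0 hdE sdE hdQ hdX sdX} => // d; apply: leqW.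
  rewrite -(bform_mulX0 sa) -(bform_mulX0 sb) -(bform_mulX0 sc) -hdE -(bform_mulX0 se).
  ring.
- exists (a * 'X), (b * 'X), (c * 'X), (e * 'X), (G * X1), (H * X1); rewrite !cohomogX //.
  split; split=> //=; try exact: size_mulX_leq.
  by rewrite -!bform_mulX1 -hdX; ring.
- exists (al *: b + be *: (b * 'X * 'X)), a, (al *: e + be *: (e * 'X * 'X)), c,
    (G * X2 + bform d b + bform d.-1 e * X3), (H * X2).
  rewrite !cohomogD ?cohomog_bform ?cohomog_bformX ?cohomogX //.
  split; split=> //=; first exact: size_mul_quadric.
  by rewrite -bform_mul_quadric // -hdQ /q1; ring.
- exists (ga *: c + de *: (c * 'X * 'X)), (ga *: e + de *: (e * 'X * 'X)), a, b,
    (G * X3), (H * X3 + bform d c + bform d.-1 e * X2).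
  rewrite !cohomogD ?cohomog_bform ?cohomog_bformX ?cohomogX //.
  split; split=> //=; first exact: size_mul_quadric.
  by rewrite -bform_mul_quadric // -hdQ /q2; ring.
Qed.

Lemma has_nf_dhomog d F : F \is d.-homog -> has_nf d F.
Proof.
suff nfX (m : 'X_{1..4}) : has_nf (mdeg m) 'X_[m].
  move=> /dhomogP Fd; rewrite [F]mpolyE big_seq.
  elim/big_ind: _ => [|G H|m /Fd /= <-]; [exact: has_nf0|exact: has_nfD|].
  exact/has_nfZ/nfX.
move Ed: (mdeg m) => d'; elim: d' m Ed => [|d' IH] m Em.
  exists 1, 0, 0, 0, 0, 0; rewrite size_poly1 !size_poly0 !cohomog0; split; split => //.
  rewrite /bform big_ord1 !big_ord0 coefC /= !mul0r !mulr0 !addr0 scale1r mulr1.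
  by move/eqP: Em; rewrite mdeg_eq0 => /eqP->; rewrite mpolyX0.
have [i mi] : exists i, m i != 0%N by apply: mnm_neq0P; rewrite -mdeg_eq0 Em.
have Em' : m = (m - U_(i) + U_(i))%MM by rewrite submK // lep1mP.
rewrite Em' mpolyXD; apply: has_nfX; apply: IH.
by move: Em; rewrite {1}Em' mdegD mdeg1; lia.
Qed.

End QuadricNormalForms.

(** * Polynomials over an algebraically closed field *)

Section ClosedField.
Variable K : closedFieldType.

Lemma closed_sqrt (x : K) : exists u, u ^+ 2 = x.
Proof.
have [u Hu] := @solve_monicpoly K 2 (fun i => if i == 0%N then x else 0) isT.
by exists u; rewrite Hu big_ord_recl big_ord1 /= mulr1 mul0r addr0.
Qed.

(** For nonconstant [p], take a root of p - 1. *)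
Lemma poly_nonroot (p : {poly K}) : p != 0 -> exists t, p.[t] != 0.
Proof.
move=> p0; have [sz1|sz1] := eqVneq (size p) 1%N.
  have /size_poly1P[c c0 ->] : size p == 1%N by rewrite sz1.
  by exists 0; rewrite hornerC.
have sz : size (p - 1) != 1%N.
  have p_gt0 : (0 < size p)%N by rewrite size_poly_gt0.
  by rewrite size_polyDl // size_polyN size_poly1; lia.
have [t /rootP] := closed_rootP _ sz.
rewrite hornerD hornerN hornerC => /eqP; rewrite subr_eq0 => /eqP pE.
by exists t; rewrite pE oner_eq0.
Qed.

Lemma poly_eq0_horner (p : {poly K}) : (forall t, p.[t] = 0) -> p = 0.
Proof.
move=> p0; apply/eqP; apply: contraT => /poly_nonroot[t].
by rewrite p0 eqxx.
Qed.

(** The multiplicity of [z] as a root is even on the left and odd on the right, unless [y] is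
    zero. *)
Lemma sqr_simple_root (x y h : {poly K}) z :
  h.[z] != 0 -> x ^+ 2 = y ^+ 2 * (('X - z%:P) * h) -> y = 0.
Proof.
move=> hz Exy; apply/eqP; apply: contraT => y0.
have h0 : h != 0 by apply: contraNneq hz => ->; rewrite horner0.
have Xz0 : 'X - z%:P != 0 :> {poly K} by rewrite polyXsubC_eq0.
have x0 : x != 0.
  by rewrite -sqrf_eq0 Exy !mulf_neq0 // expf_neq0.
have /(congr1 (fun p => odd (mup z p))) := Exy.
rewrite !expr2 !mupM ?mulf_neq0 // !addnn (@mupNroot _ z h) //.
by rewrite (mup_XsubCX 1) eqxx addn0 !oddD odd_double odd_double.
Qed.

End ClosedField.

(** * The curve and its general points *)

Section Curve.
Variables (K : closedFieldType) (charK0 : [pchar K] =i pred0).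
Variables (al be ga de : K).
Hypotheses (al_neq0 : al != 0) (be_neq0 : be != 0).
Hypotheses (ga_neq0 : ga != 0) (de_neq0 : de != 0).
Hypothesis disc_neq0 : al * de - be * ga != 0.

Local Notation A := {mpoly K[4]}.
Local Notation X0 := ('X_o0 : A).
Local Notation X1 := ('X_o1 : A).
Local Notation X2 := ('X_o2 : A).
Local Notation X3 := ('X_o3 : A).
Local Notation q1 := (q1 al be).
Local Notation q2 := (q2 ga de).

(** * The function field of the curve as a biquadratic extension of K(t) *)

Definition fpol : {poly K} := al%:P + be *: 'X^2.
Definition gpol : {poly K} := ga%:P + de *: 'X^2.

Lemma fpolE t : fpol.[t] = al + be * t ^+ 2.
Proof. by rewrite hornerD hornerC hornerZ hornerXn. Qed.

Lemma gpolE t : gpol.[t] = ga + de * t ^+ 2.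
Proof. by rewrite hornerD hornerC hornerZ hornerXn. Qed.

Lemma neq0_2 : (2%:R : K) != 0.
Proof. by move/pcharf0P: charK0 => ->. Qed.

(** The roots of f are z and -z, distinct since z is nonzero; the discriminant keeps them away from
    the roots of g. *)
Lemma fpol_root : exists2 z, fpol = ('X - z%:P) * (be *: ('X + z%:P)) &
  z != 0 /\ gpol.[z] != 0.
Proof.
have [z zE] := closed_sqrt (- al / be); exists z.
  rewrite /fpol -!mul_polyC; apply/eqP; rewrite -subr_eq0; apply/eqP.
  transitivity ((al + be * z ^+ 2)%:P : {poly K}); last first.
    by rewrite zE mulrC divfK // subrr.
  by rewrite !(rmorphD, rmorphM, rmorphXn) /=; ring.
split; first by rewrite -sqrf_eq0 zE mulf_neq0 ?oppr_eq0 ?invr_eq0.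
rewrite gpolE zE; apply: contraNneq disc_neq0 => E.
have -> : al * de - be * ga = - be * (ga + de * (- al / be)) by field.
by rewrite E mulr0.
Qed.

Lemma gpol_root : exists2 z, gpol = ('X - z%:P) * (de *: ('X + z%:P)) & z != 0.
Proof.
have [z zE] := closed_sqrt (- ga / de); exists z.
  rewrite /gpol -!mul_polyC; apply/eqP; rewrite -subr_eq0; apply/eqP.
  transitivity ((ga + de * z ^+ 2)%:P : {poly K}); last first.
    by rewrite zE mulrC divfK // subrr.
  by rewrite !(rmorphD, rmorphM, rmorphXn) /=; ring.
by rewrite -sqrf_eq0 zE mulf_neq0 ?oppr_eq0 ?invr_eq0.
Qed.

Lemma neq0_cofactor (x z : K) : x != 0 -> z != 0 -> (x *: ('X + z%:P)).[z] != 0.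
Proof.
move=> x0 z0; rewrite hornerZ hornerD hornerX hornerC -mulr2n -mulr_natl.
by rewrite !mulf_neq0 // neq0_2.
Qed.

Lemma fpol_nonsquare (x y : {poly K}) : x ^+ 2 = y ^+ 2 * fpol -> y = 0.
Proof.
have [z -> [z0 _]] := fpol_root.
by apply: sqr_simple_root; apply: neq0_cofactor.
Qed.

Lemma gpol_nonsquare (x y : {poly K}) : x ^+ 2 = y ^+ 2 * gpol -> y = 0.
Proof.
have [z -> z0] := gpol_root.
by apply: sqr_simple_root; apply: neq0_cofactor.
Qed.

Lemma fgpol_nonsquare (x y : {poly K}) : x ^+ 2 = y ^+ 2 * (fpol * gpol) -> y = 0.
Proof.
have [z -> [z0 gz]] := fpol_root; rewrite -(mulrA ('X - z%:P)).
by apply: sqr_simple_root; rewrite hornerM mulf_neq0 // neq0_cofactor.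
Qed.

Lemma fpol_neq0 : fpol != 0.
Proof.
apply/eqP => f0; have := @fpol_nonsquare 0 1.
by rewrite f0 mulr0 expr0n => /(_ erefl)/eqP; rewrite oner_eq0.
Qed.

Lemma gpol_neq0 : gpol != 0.
Proof.
apply/eqP => f0; have := @gpol_nonsquare 0 1.
by rewrite f0 mulr0 expr0n => /(_ erefl)/eqP; rewrite oner_eq0.
Qed.

(* The norm of [a + b u + c w + e u w] from [K(t)(u, w)], where [u^2 = f] and
   [w^2 = g], down to [K(t)]; [normc] and [norms] are the components of the
   intermediate norm, to [K(t)(u)]. *)
Definition normc (a b c e : {poly K}) : {poly K} :=
  a ^+ 2 + b ^+ 2 * fpol - (c ^+ 2 + e ^+ 2 * fpol) * gpol.
Definition norms (a b c e : {poly K}) : {poly K} :=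
  a * b *+ 2 - c * e * gpol *+ 2.
Definition norm a b c e : {poly K} :=
  normc a b c e ^+ 2 - norms a b c e ^+ 2 * fpol.

(** K(t)(u, w) is a field of degree 4 over K(t), because none of f, g and fg is a square. *)
Lemma norm_eq0 a b c e : norm a b c e = 0 -> [/\ a = 0, b = 0, c = 0 & e = 0].
Proof.
move/eqP; rewrite subr_eq0 => /eqP Enorm.
have s0 := fpol_nonsquare Enorm.
have c0 : normc a b c e = 0.
  by apply/eqP; rewrite -sqrf_eq0 Enorm s0 expr0n mul0r.
(* With u^2 = f, the vanishing of the intermediate norm reads (a + b u)^2 = g (c + e u)^2.
   Multiplying by (c - e u)^2 gives (x + y u)^2 = g N^2, where N is the norm of c + e u. Hence x y =
   0, and a nonzero N would make g or fg a square. *)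
set N := c ^+ 2 - e ^+ 2 * fpol.
set x := a * c - b * e * fpol; set y := b * c - a * e.
have Exy : x ^+ 2 + y ^+ 2 * fpol = N ^+ 2 * gpol.
  transitivity (N ^+ 2 * gpol + normc a b c e * (c ^+ 2 + e ^+ 2 * fpol)
                - norms a b c e * (c * e * fpol *+ 2)); last by rewrite s0 c0; ring.
  by rewrite /x /y /N /normc /norms; ring.
have xy0 : x * y = 0.
  have two_inj : 2%:R != 0 :> {poly K}.
    by rewrite -polyC_natr polyC_eq0 neq0_2.
  apply: (mulfI two_inj); rewrite mulr0.
  transitivity (norms a b c e * (c ^+ 2 + e ^+ 2 * fpol) - normc a b c e * (c * e *+ 2)).
    by rewrite /x /y /normc /norms; ring.
  by rewrite s0 c0; ring.
have N0 : N = 0.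
  have /orP[/eqP x0|/eqP y0] : (x == 0) || (y == 0) by rewrite -mulf_eq0 xy0.
    apply: (@fgpol_nonsquare (y * fpol)).
    have -> : (y * fpol) ^+ 2 = (y ^+ 2 * fpol) * fpol by ring.
    by move: Exy; rewrite x0 expr0n add0r => ->; ring.
  by apply: (@gpol_nonsquare x); rewrite -Exy y0 expr0n mul0r addr0.
have e0 : e = 0.
  by apply: (@fpol_nonsquare c); apply/eqP; rewrite -subr_eq0 -/N N0.
have {N0} cc0 : c = 0.
  by apply/eqP; rewrite -sqrf_eq0; move: N0; rewrite /N e0 expr0n mul0r subr0 => ->.
move: s0 c0; rewrite /norms /normc e0 cc0 !(mul0r, mulr0) expr0n !(mul0r, addr0,
  subr0) mul0rn subr0.
move=> ab0 abf.
have /orP[/eqP a0|/eqP b0] : (a == 0) || (b == 0).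
  rewrite -mulf_eq0; have two_inj : 2%:R != 0 :> {poly K}.
    by rewrite -polyC_natr polyC_eq0 neq0_2.
  by rewrite -(inj_eq (mulfI two_inj)) mulr0 mulr_natl ab0.
- move: abf; rewrite a0 expr0n add0r => /eqP; rewrite mulf_eq0 (negPf fpol_neq0) orbF.
  by rewrite sqrf_eq0 => /eqP->.
- move: abf; rewrite b0 expr0n mul0r addr0 => /eqP; rewrite sqrf_eq0 => /eqP->.
  by [].
Qed.

(** * The affine chart X0 = 1 of the curve *)

Definition curve_pt (t u w : K) : 'rV[K]_4 := \row_(i < 4) nth 0 [:: 1; t; u; w] i.

Definition on_curve (t u w : K) : Prop :=
  u ^+ 2 = al + be * t ^+ 2 /\ w ^+ 2 = ga + de * t ^+ 2.

(** Only points of the chart are tested. For forms this already gives membership in the ideal of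
    [q1] and [q2], by [vanish_dhomog]. *)
Definition vanish (F : A) : Prop := forall t u w, on_curve t u w ->
  F.@[curve_pt t u w 0] = 0.

Lemma curve_pt0 t u w : curve_pt t u w 0 o0 = 1. Proof. by rewrite mxE. Qed.
Lemma curve_pt1 t u w : curve_pt t u w 0 o1 = t. Proof. by rewrite mxE. Qed.
Lemma curve_pt2 t u w : curve_pt t u w 0 o2 = u. Proof. by rewrite mxE. Qed.
Lemma curve_pt3 t u w : curve_pt t u w 0 o3 = w. Proof. by rewrite mxE. Qed.
Definition curve_ptE := (curve_pt0, curve_pt1, curve_pt2, curve_pt3).

Lemma on_curve_over t : exists u w, on_curve t u w.
Proof.
have [u uE] := closed_sqrt (al + be * t ^+ 2).
by have [w wE] := closed_sqrt (ga + de * t ^+ 2); exists u, w.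
Qed.

Lemma meval_q1 v : q1.@[v] = v o2 ^+ 2 - (al * v o0 ^+ 2 + be * v o1 ^+ 2).
Proof. by rewrite mevalB mevalD !mevalZ !rmorphXn /= !mevalXU. Qed.

Lemma meval_q2 v : q2.@[v] = v o3 ^+ 2 - (ga * v o0 ^+ 2 + de * v o1 ^+ 2).
Proof. by rewrite mevalB mevalD !mevalZ !rmorphXn /= !mevalXU. Qed.

Lemma on_curve_q t u w : on_curve t u w ->
  q1.@[curve_pt t u w 0] = 0 /\ q2.@[curve_pt t u w 0] = 0.
Proof.
by move=> [uE wE]; rewrite meval_q1 meval_q2 !curve_ptE uE wE !expr1n !mulr1 !subrr.
Qed.

(* The vector field on the cone over the curve that is tangent to the
   hyperplanes where [X0] is constant. *)
Definition der (F : A) : A :=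
  locked (X2 * X3 * F^`M(o1) + be%:MP * X1 * X3 * F^`M(o2)
          + de%:MP * X1 * X2 * F^`M(o3)).

Lemma derD F G : der (F + G) = der F + der G.
Proof. by rewrite /der -!lock !mderivD; ring. Qed.

Lemma derM F G : der (F * G) = der F * G + F * der G.
Proof. by rewrite /der -!lock !mderivM; ring. Qed.

Lemma derC c : der c%:MP = 0.
Proof. by rewrite /der -!lock !mderivC !mulr0 !addr0. Qed.

Lemma derZ c F : der (c *: F) = c *: der F.
Proof. by rewrite -!mul_mpolyC derM derC mul0r add0r. Qed.

Lemma der0 : der 0 = 0.
Proof. by rewrite -mpolyC0 derC. Qed.

Lemma derB F G : der (F - G) = der F - der G.
Proof. by rewrite -scaleN1r derD derZ scaleN1r. Qed.

Lemma mderivXU (i j : 'I_4) : ('X_j : A)^`M(i) = (i == j)%:R.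
Proof.
rewrite mderivX mnm1E eq_sym; case: eqP => [->|_]; last by rewrite scale0r.
by rewrite submm mpolyX0 scale1r.
Qed.

Lemma derX0 : der X0 = 0. Proof. by rewrite /der -!lock !mderivXU /=; ring. Qed.
Lemma derX1 : der X1 = X2 * X3. Proof. by rewrite /der -!lock !mderivXU /=; ring. Qed.
Lemma derX2 : der X2 = be%:MP * X1 * X3. Proof. by rewrite /der -!lock !mderivXU /=;
  ring. Qed.
Lemma derX3 : der X3 = de%:MP * X1 * X2. Proof. by rewrite /der -!lock !mderivXU /=;
  ring. Qed.

Lemma der_q1 : der q1 = 0.
Proof. by rewrite /q1 !expr2 derB derD !derZ !derM derX0 derX1 derX2 -!mul_mpolyC;
  ring. Qed.

Lemma der_q2 : der q2 = 0.
Proof. by rewrite /q2 !expr2 derB derD !derZ !derM derX0 derX1 derX3 -!mul_mpolyC;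
  ring. Qed.

Lemma meval_bform n (a : {poly K}) t u w :
  (size a <= n)%N -> (bform n a).@[curve_pt t u w 0] = a.[t].
Proof.
move=> sz_a; rewrite raddf_sum (horner_coef_wide _ sz_a); apply: eq_bigr => j _ /=.
by rewrite mevalZ mevalM !rmorphXn /= !mevalXU !curve_ptE expr1n mul1r.
Qed.

Lemma derXn F k : der (F ^+ k) = (F ^+ k.-1 * der F) *+ k.
Proof.
elim: k => [|[|k] IH]; first by rewrite expr0 -mpolyC1 derC mulr0n.
  by rewrite expr1 expr0 mul1r mulr1n.
by rewrite exprS derM IH /= !mulrS !exprS; ring.
Qed.

Lemma der_sum (I : Type) (s : seq I) (P : pred I) (f : I -> A) :
  der (\sum_(i <- s | P i) f i) = \sum_(i <- s | P i) der (f i).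
Proof. exact: (big_morph der derD der0). Qed.

Lemma meval_der_bform n (a : {poly K}) t u w :
  (size a <= n)%N -> (der (bform n a)).@[curve_pt t u w 0] = a^`().[t] * u * w.
Proof.
move=> sz_a; have aE : a = \sum_(j < n) a`_j *: 'X^j.
  rewrite -poly_def; apply/polyP => j; rewrite coef_poly.
  by case: ltnP => // lt_nj; rewrite nth_default // (leq_trans sz_a).
rewrite {2}aE der_sum !raddf_sum horner_sum !mulr_suml; apply: eq_bigr => j _ /=.
rewrite derZ derM !derXn derX0 derX1 mulr0 mul0rn mul0r add0r derivZ derivXn.
rewrite mevalZ mevalM raddfMn /= !mevalM !rmorphXn /= !mevalXU !curve_ptE expr1n mul1r.
by rewrite hornerZ hornerMn hornerXn; ring.
Qed.

(* The second equation is the derivative of the first one along the curve; it is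
   what makes [der] preserve the forms that vanish on the curve. *)
Definition chart_nf (F : A) (a b c e : {poly K}) : Prop :=
  forall t u w, on_curve t u w ->
    F.@[curve_pt t u w 0] = a.[t] + b.[t] * u + c.[t] * w + e.[t] * (u * w) /\
    (der F).@[curve_pt t u w 0] =
      a^`().[t] * u * w
      + (b^`().[t] * u * w * u + b.[t] * (be * t * w))
      + (c^`().[t] * u * w * w + c.[t] * (de * t * u))
      + (e^`().[t] * u * w * (u * w)
         + e.[t] * (be * t * w * w + u * (de * t * u))).

Lemma vanish_ideal G H t u w : on_curve t u w ->
  (q1 * G + q2 * H).@[curve_pt t u w 0] = 0 /\
    (der (q1 * G + q2 * H)).@[curve_pt t u w 0] = 0.
Proof.
move=> /on_curve_q[]; have := der_q1; have := der_q2.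
move: q1 q2 => Q1 Q2 D2 D1 Q1z Q2z.
by rewrite derD !derM D1 D2 !mul0r !add0r !mevalD !mevalM Q1z Q2z !mul0r addr0.
Qed.

Lemma chart_nf_bform d (a b c e : {poly K}) G H :
  (size a <= d.+1)%N -> (size b <= d)%N -> (size c <= d)%N -> (size e <= d.-1)%N ->
  chart_nf (bform d.+1 a + bform d b * X2 + bform d c * X3 + bform d.-1 e * (X2 * X3)
            + q1 * G + q2 * H) a b c e.
Proof.
move=> sa sb sc se t u w tC; rewrite -addrA; have [] := vanish_ideal G H tC.
move: (_ + q2 * H) => I I0 DI0;
  rewrite !derD !derM derX2 derX3 !mevalD !mevalM !(mevalD, mevalM).
rewrite I0 DI0 !meval_der_bform // !meval_bform // !mevalXU !mevalC !curve_ptE.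
by split; ring.
Qed.

Lemma chart_nf_dhomog d F : F \is d.-homog -> exists a b c e : {poly K},
  [/\ (size a <= d.+1)%N, (size b <= d)%N, (size c <= d)%N & (size e <= d.-1)%N] /\
  chart_nf F a b c e.
Proof.
move=> /(has_nf_dhomog al be ga de)[a [b [c [e [G [H [[sa sb sc se] [_ _ ->]]]]]]]].
by exists a, b, c, e; split=> //; apply: chart_nf_bform.
Qed.

Lemma chart_nfD F G a b c e a' b' c' e' :
  chart_nf F a b c e -> chart_nf G a' b' c' e' ->
  chart_nf (F + G) (a + a') (b + b') (c + c') (e + e').
Proof.
move=> nF nG t u w tC; have [F1 F2] := nF _ _ _ tC; have [G1 G2] := nG _ _ _ tC.
by rewrite derD !mevalD F1 F2 G1 G2 !derivD !hornerD; split; ring.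
Qed.

Lemma chart_nfZ x F a b c e :
  chart_nf F a b c e -> chart_nf (x *: F) (x *: a) (x *: b) (x *: c) (x *: e).
Proof.
move=> nF t u w tC; have [F1 F2] := nF _ _ _ tC.
by rewrite derZ !mevalZ F1 F2 !derivZ !hornerZ; split; ring.
Qed.

Lemma chart_nf_exists F : exists a b c e, chart_nf F a b c e.
Proof.
elim/mpolyind: F => [|x m F _ _ [a [b [c [e nF]]]]].
  have [a [b [c [e [_ nf]]]]] := chart_nf_dhomog (dhomog0 K mdeg 0).
  by exists a, b, c, e.
have Xm : ('X_[m] : A) \is (mdeg m).-homog by rewrite dhomogX.
have [a' [b' [c' [e' [_ nX]]]]] := chart_nf_dhomog Xm.
by do 4!eexists; apply: chart_nfD; [apply: chart_nfZ nX|apply: nF].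
Qed.

(** The curve is stable under u -> -u and w -> -w, and averaging over these four sign changes
    separates the four terms of the normal form. *)
Lemma chart_nf_vanish F a b c e :
  chart_nf F a b c e -> vanish F -> [/\ a = 0, b = 0, c = 0 & e = 0].
Proof.
move=> nF vF.
have signs t u w : on_curve t u w ->
    [/\ a.[t] = 0, b.[t] * u = 0, c.[t] * w = 0 & e.[t] * (u * w) = 0].
  move=> [uE wE]; have two0 := neq0_2.
  have four0 : 4%:R != 0 :> K by move/pcharf0P: charK0 => ->.
  pose h u' w' := a.[t] + b.[t] * u' + c.[t] * w' + e.[t] * (u' * w').
  have h0 u' w' : u' ^+ 2 = u ^+ 2 -> w' ^+ 2 = w ^+ 2 -> h u' w' = 0.
    move=> u'E w'E; have tC : on_curve t u' w' by split; rewrite ?u'E ?w'E.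
    by rewrite -(vF _ _ _ tC); case: (nF _ _ _ tC).
  have h1 := h0 u w erefl erefl; have h2 := h0 (- u) w (sqrrN _) erefl.
  have h3 := h0 u (- w) erefl (sqrrN _); have h4 := h0 (- u) (- w) (sqrrN _) (sqrrN _).
  split; apply: (mulfI four0); rewrite mulr0.
  - transitivity (h u w + h (- u) w + h u (- w) + h (- u) (- w)); first by rewrite /h; ring.
    by rewrite h1 h2 h3 h4 !addr0.
  - transitivity (h u w - h (- u) w + h u (- w) - h (- u) (- w)); first by rewrite /h; ring.
    by rewrite h1 h2 h3 h4 subr0 !addr0 subr0.
  - transitivity (h u w + h (- u) w - h u (- w) - h (- u) (- w)); first by rewrite /h; ring.
    by rewrite h1 h2 h3 h4 addr0 !subr0.
  - transitivity (h u w - h (- u) w - h u (- w) + h (- u) (- w)); first by rewrite /h; ring.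
    by rewrite h1 h2 h3 h4 addr0 !subr0.
have f0 := fpol_neq0.
have g0 := gpol_neq0.
(* Squaring eliminates u and w: b(t) u = 0 becomes b^2 f = 0 at every t, which is an identity of
   polynomials. *)
have sqr_eq0 (p h : {poly K}) : h != 0 -> (forall t, p.[t] ^+ 2 * h.[t] = 0) -> p = 0.
  move=> h0 ph; have /eqP : p ^+ 2 * h = 0.
    by apply: poly_eq0_horner => t; rewrite hornerM horner_exp.
  by rewrite mulf_eq0 (negPf h0) orbF sqrf_eq0 => /eqP.
split.
- by apply: poly_eq0_horner => t; have [u [w /signs[]]] := on_curve_over t.
- apply: (sqr_eq0 _ fpol) => // t; have [u [w tC]] := on_curve_over t.
  have [_ b0 _ _] := signs _ _ _ tC.
  by rewrite fpolE; case: tC => <- _; rewrite -exprMn b0 expr0n.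
- apply: (sqr_eq0 _ gpol) => // t; have [u [w tC]] := on_curve_over t.
  have [_ _ c0 _] := signs _ _ _ tC.
  by rewrite gpolE; case: tC => _ <-; rewrite -exprMn c0 expr0n.
- apply: (sqr_eq0 _ (fpol * gpol)); first by rewrite mulf_neq0.
  move=> t; have [u [w tC]] := on_curve_over t; have [_ _ _ e0] := signs _ _ _ tC.
  by rewrite hornerM fpolE gpolE; case: tC => <- <-; rewrite -!exprMn e0 expr0n.
Qed.

Lemma vanish_der F : vanish F -> vanish (der F).
Proof.
have [a [b [c [e nF]]]] := chart_nf_exists F.
move=> /(chart_nf_vanish nF)[a0 b0 c0 e0] t u w tC; have [_ ->] := nF _ _ _ tC.
by rewrite a0 b0 c0 e0 !deriv0 !horner0; ring.
Qed.

(** The remainder of [F] is zero. The degrees of the cofactors are recorded because the descent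
    through the powers of the ideal depends on them. *)
Lemma vanish_dhomog d F : F \is d.-homog -> vanish F ->
  exists G H, [/\ cohomog d G, cohomog d H & F = q1 * G + q2 * H].
Proof.
move=> Fd vF.
have [a [b [c [e [G [H [[sa sb sc se] [cG cH EF]]]]]]]] := has_nf_dhomog al be ga de Fd.
have nF : chart_nf F a b c e by rewrite EF; apply: chart_nf_bform.
exists G, H; split=> //; rewrite EF; have [-> -> -> ->] := chart_nf_vanish nF vF.
by rewrite !bform_poly0 !mul0r !add0r.
Qed.

(** * Irreducibility of the curve and order of contact with it *)

Definition lift_poly (a : {poly K}) : A := (map_poly (@mpolyC 4 K) a).[X1].

Lemma lift_polyC c : lift_poly c%:P = c%:MP.
Proof. by rewrite /lift_poly map_polyC hornerC. Qed.

Lemma lift_poly_mulX a c : lift_poly (a * 'X + c%:P) = lift_poly a * X1 + c%:MP.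
Proof. by rewrite /lift_poly rmorphD rmorphM /= map_polyX map_polyC !hornerE. Qed.

Lemma lift_polyD a b : lift_poly (a + b) = lift_poly a + lift_poly b.
Proof. by rewrite /lift_poly rmorphD hornerD. Qed.

Lemma meval_lift_poly a t u w : (lift_poly a).@[curve_pt t u w 0] = a.[t].
Proof.
elim/poly_ind: a => [|a c IH]; first by rewrite -polyC0 lift_polyC mevalC hornerC.
by rewrite lift_poly_mulX mevalD mevalM IH mevalXU mevalC curve_ptE !hornerE.
Qed.

Lemma der_lift_poly a : der (lift_poly a) = X2 * X3 * lift_poly a^`().
Proof.
elim/poly_ind: a => [|a c IH].
  by rewrite deriv0 -polyC0 lift_polyC derC mpolyC0 mulr0.
rewrite lift_poly_mulX derD derM IH derC derX1 addr0 derivD derivC addr0 derivM derivX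
  mulr1.
by have := lift_poly_mulX a^`() 0; rewrite polyC0 mpolyC0 !addr0 lift_polyD => ->; ring.
Qed.

(** Irreducibility in a usable form: a function that is not zero on the curve divides there a
    nonzero polynomial in t alone, so it is nonzero over all but finitely many t. The cofactor is
    the product of the three other conjugates. *)
Lemma norm_cofactor F : vanish F \/
  exists2 N : {poly K}, N != 0 &
    exists F', forall t u w, on_curve t u w ->
      F.@[curve_pt t u w 0] * F'.@[curve_pt t u w 0] = N.[t].
Proof.
have [a [b [c [e nF]]]] := chart_nf_exists F.
have [N0|N0] := eqVneq (norm a b c e) 0.
  left=> t u w tC; have [-> _] := nF _ _ _ tC.
  have [-> -> -> ->] := norm_eq0 N0.
  by rewrite !horner0; ring.
right; exists (norm a b c e) => //.
exists ((lift_poly a + lift_poly b * X2 - (lift_poly c + lift_poly e * X2) * X3)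
  * (lift_poly (normc a b c e) - lift_poly (norms a b c e) * X2)) => t u w tC.
have [-> _] := nF _ _ _ tC; rewrite !(mevalM, mevalB,
  mevalD) !meval_lift_poly !mevalXU !curve_ptE.
case: tC; rewrite -(fpolE) -(gpolE) => uE wE.
rewrite /norm /normc /norms; move: fpol gpol uE wE => f g uE wE.
by rewrite !(hornerD, hornerN, hornerM, horner_exp, hornerMn) -uE -wE; ring.
Qed.

(* Vanishing to order [k] at [v] along the integral curve of [der]. *)
Definition contact (v : 'rV[K]_4) k F : Prop := forall i, (i < k)%N ->
  (iter i der F).@[v 0] = 0.

Lemma contactS v k F : contact v k.+1 F <-> F.@[v 0] = 0 /\ contact v k (der F).
Proof.
split=> [vF|[F0 vF] [|i] // lt_ik]; last by rewrite iterSr vF.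
by split=> [|i lt_ik]; [apply: (vF 0%N) | rewrite -iterSr vF].
Qed.

Lemma contactW v k l F : (l <= k)%N -> contact v k F -> contact v l F.
Proof. by move=> le_lk vF i lt_il; apply/vF/(leq_trans lt_il). Qed.

Lemma iter_derD i F G : iter i der (F + G) = iter i der F + iter i der G.
Proof. by elim: i => //= i ->; rewrite derD. Qed.

Lemma iter_derZ i c F : iter i der (c *: F) = c *: iter i der F.
Proof. by elim: i => //= i ->; rewrite derZ. Qed.

Lemma iter_der0 i : iter i der 0 = 0.
Proof. by elim: i => //= i ->; rewrite der0. Qed.

Lemma iter_der_sum i (I : Type) (s : seq I) (P : pred I) (f : I -> A) :
  iter i der (\sum_(j <- s | P j) f j) = \sum_(j <- s | P j) iter i der (f j).
Proof. exact: (big_morph _ (iter_derD i) (iter_der0 i)). Qed.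

Lemma contactD v k F G : contact v k F -> contact v k G -> contact v k (F + G).
Proof. by move=> vF vG i lt_ik; rewrite iter_derD mevalD vF ?vG ?addr0. Qed.

Lemma contactZ v k c F : contact v k F -> contact v k (c *: F).
Proof. by move=> vF i lt_ik; rewrite iter_derZ mevalZ vF ?mulr0. Qed.

Lemma contactB v k F G : contact v k F -> contact v k G -> contact v k (F - G).
Proof. by move=> vF vG; rewrite -scaleN1r; apply/contactD/contactZ. Qed.

Lemma contact_sum v k (I : Type) (s : seq I) (P : pred I) (f : I -> A) :
  (forall i, P i -> contact v k (f i)) -> contact v k (\sum_(i <- s | P i) f i).
Proof.
move=> vf; elim/big_ind: _ => [i _|F G|i Pi]; [|exact: contactD|exact: vf].
by rewrite iter_der0 meval0.
Qed.

Lemma contact_mul v k F G : contact v k G -> contact v k (F * G).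
Proof.
elim: k F G => [//|k IH] F G /contactS[G0 vG]; apply/contactS; split.
  by rewrite mevalM G0 mulr0.
rewrite derM; apply: contactD; apply: IH => //.
by apply: (@contactW _ k.+1) => //; apply/contactS.
Qed.

(** By Leibniz, [F * der G] differs from [der (F * G)] by a multiple of [G], whose contact of order
    one less is known by induction. *)
Lemma contact_cancel (v : 'rV[K]_4) k (F G : A) : F.@[v 0] != 0 ->
  contact v k (F * G) -> contact v k G.
Proof.
move=> F0; elim: k G => [//|k IH] G vFG; have vG : contact v k G.
  by apply: IH; apply: contactW vFG.
move/contactS: vFG => [FG0 vDFG]; apply/contactS; split.
  by move/eqP: FG0; rewrite mevalM mulf_eq0 (negPf F0) => /eqP.
apply: IH; have -> : F * der G = der (F * G) - der F * G by rewrite derM; ring.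
by apply: contactB => //; apply: contact_mul.
Qed.

Lemma contact_iter v k l F : contact v k F -> contact v (k - l) (iter l der F).
Proof. by move=> vF i lt_ik; rewrite -iterD vF //; lia. Qed.

Lemma vanish_iter i F : vanish F -> vanish (iter i der F).
Proof.
by elim: i => //= i IH /IH; apply: (vanish_der).
Qed.

Lemma contact_vanish t u w k F : on_curve t u w -> vanish F -> contact (curve_pt t u w) k F.
Proof. by move=> tC vF i _; apply: vanish_iter. Qed.

Lemma mult_ge_contact v k F : mult_ge v k F -> contact v k F.
Proof.
elim: k F => [//|k IH] F mF; apply/contactS; split.
  by apply/mult_ge1/(mult_geW _ mF).
apply: IH; rewrite /der -lock.
by do !apply: mult_geD; apply: mult_ge_mull; apply: mult_ge_mderiv.
Qed.

(** On functions of t the field [der] is u w d/dt, and u w can be cancelled at this point. So a' has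
    infinite contact too, and vanishes by induction on the degree. In characteristic 0, [a] is then
    a constant with value 0. *)
Lemma contact_lift_poly_eq0 t u w a : u * w != 0 ->
  (forall k, contact (curve_pt t u w) k (lift_poly a)) -> a = 0.
Proof.
move=> uw0; have [n] := ubnP (size a); elim: n a => // n IH a lt_an contact_a.
apply/eqP; apply: contraT => a0; have a'0 : a^`() = 0.
  apply: IH => [|k]; first exact: leq_trans (lt_size_deriv a0) _.
  apply: (@contact_cancel _ _ (X2 * X3)); first by rewrite mevalM !mevalXU !curve_ptE.
  by rewrite -der_lift_poly; case: (contactS (curve_pt t u w) k (lift_poly a)) => /(_
    (contact_a _))[].
have aC : a = (a`_0)%:P.
  apply: size1_polyC; apply/leq_sizeP => -[//|j] _.
  have /eqP := congr1 (fun p : {poly K} => p`_j) a'0.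
  rewrite coef_deriv coef0 -mulr_natr mulf_eq0.
  by move/pcharf0P: charK0 => -> /=; rewrite orbF => /eqP.
have := contact_a 1%N 0%N isT; rewrite /= meval_lift_poly aC hornerC => a00.
by move: a0; rewrite aC a00 eqxx.
Qed.

(** Otherwise a nonzero polynomial in t, a multiple of [F] on the curve, would have infinite contact
    as well. *)
Lemma contact_infinite t u w F : on_curve t u w -> u * w != 0 ->
  (forall k, contact (curve_pt t u w) k F) -> vanish F.
Proof.
move=> tC uw0 Fcontact; have [//|[N N0 [F' FF']]] := norm_cofactor F.
have vN : vanish (lift_poly N - F' * F).
  by move=> t' u' w' t'C; rewrite mevalB mevalM meval_lift_poly -(FF' _ _ _ t'C) mulrC
    subrr.
case/eqP: N0; apply: (contact_lift_poly_eq0 uw0) => k.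
rewrite -[lift_poly N](subrK (F' * F)); apply: contactD; first exact: contact_vanish tC vN.
exact: contact_mul.
Qed.

Lemma generic_point (N : {poly K}) : N != 0 ->
  exists t u w, [/\ on_curve t u w, u * w != 0 & N.[t] != 0].
Proof.
move=> N0; have /poly_nonroot[t] : N * (fpol * gpol) != 0.
  rewrite !mulf_neq0 //; first exact: (fpol_neq0).
  exact: (gpol_neq0).
rewrite !hornerM fpolE gpolE !mulf_eq0 !negb_or => /and3P[Nt ft gt].
have [u [w tC]] := on_curve_over t; exists t, u, w; split=> //.
by case: tC ft gt => <- <-; rewrite !sqrf_eq0 => u0 w0; rewrite mulf_neq0.
Qed.

(** * Wronskians and the conditions imposed by a general point *)

Definition wronskian n (F : 'I_n -> A) : A := \det (\matrix_(i, j) iter i der (F j)).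

(** If the Wronskian of n + 1 functions vanishes but that of the first n does not, all of them
    satisfy a linear differential equation of order n. A solution with zero initial data at a
    general point has infinite contact there, hence is zero on the curve. *)
Lemma wronskian_nonvanishing n (F : 'I_n -> A) :
  (forall c : 'rV[K]_n, vanish (\sum_j c 0 j *: F j) -> c = 0) ->
  ~ vanish (wronskian F).
Proof.
elim: n F => [|n IH] F indep vW.
  have [t [u [w [tC _ _]]]] := generic_point (oner_neq0 _).
  by have /eqP := vW _ _ _ tC; rewrite /wronskian det_mx00 meval1 oner_eq0.
pose F' j := F (lift ord_max j); pose M := \matrix_(i, j) iter i der (F j) : 'M[A]_n.+1.
have indep' (c : 'rV[K]_n) : vanish (\sum_j c 0 j *: F' j) -> c = 0.
  move=> vc; pose c' : 'rV[K]_n.+1 := \row_j oapp (c 0) 0 (unlift ord_max j).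
  have c'0 : c' = 0.
    apply: indep; rewrite big_ord_recr /= mxE unlift_none scale0r addr0.
    move: vc; congr (vanish _); apply: eq_bigr => j _; rewrite mxE.
    have -> : widen_ord (leqnSn n) j = lift ord_max j.
      by apply: val_inj; rewrite /= /bump leqNgt ltn_ord.
    by rewrite liftK.
  apply/rowP => j; have /rowP/(_ (lift ord_max j)) := c'0.
  by rewrite !mxE liftK.
have [/(IH _ indep') //|[N N0 [W' WW']]] := norm_cofactor (wronskian F').
have [t [u [w [tC uw0 Nt]]]] := generic_point N0; pose p := curve_pt t u w.
have W0 : (wronskian F').@[p 0] != 0.
  by apply: contraNneq Nt => W0; rewrite -(WW' _ _ _ tC) W0 mul0r.
(* These are [n] linear conditions on [n.+1] coefficients, so some nonzero combination [Fc] has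
   contact of order [n] at [p]. *)
have [c /sub_kermxP cE c0] : exists2 c : 'rV[K]_n.+1,
    (c <= kermx (\matrix_(j < n.+1, l < n) (iter l der (F j)).@[p 0]))%MS & c != 0.
  apply/rowV0Pn; rewrite -mxrank_eq0 mxrank_ker subn_eq0 -ltnNge ltnS.
  exact: rank_leq_col.
pose Fc := \sum_j c 0 j *: F j.
case/eqP: c0; apply: indep; apply: (contact_infinite tC uw0); rewrite -/Fc -/p.
have Fc_contact : contact p n Fc.
  move=> l lt_ln; have /rowP/(_ (Ordinal lt_ln)) := cE; rewrite !mxE => <-.
  rewrite iter_der_sum raddf_sum; apply: eq_bigr => j _ /=.
  by rewrite mxE iter_derZ mevalZ.
pose cf l := cofactor M l ord_max.
(* Expanding the Wronskian along its last column gives a differential operator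
   of order [n] that annihilates every [F j] modulo the ideal of the curve. *)
have vR : vanish (\sum_l cf l * iter l der Fc).
  move=> t' u' w' t'C; rewrite [X in X.@[_]](_ : _ =
      \sum_j c 0 j *: (\adj M *m M) ord_max j).
    rewrite raddf_sum big1 // => j _ /=; rewrite mul_adj_mx mevalZ mxE mevalMn.
    by rewrite (vW _ _ _ t'C) mul0rn mulr0.
  under eq_bigr do rewrite iter_der_sum mulr_sumr.
  rewrite exchange_big; apply: eq_bigr => j _ /=; rewrite mxE scaler_sumr.
  by apply: eq_bigr => l _; rewrite iter_derZ -scalerAr !mxE.
have cfn : (cf ord_max).@[p 0] != 0.
  rewrite /cf /cofactor mevalM; apply: mulf_neq0.
    by rewrite rmorphXn rmorphN1 /= expf_neq0 // oppr_eq0 oner_eq0.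
  congr (_.@[_] != 0): W0; congr (\det _); apply/matrixP => i j; rewrite !mxE.
  by rewrite lift_max.
(* Past order [n], the equation expresses the n-th derivative of [Fc] through the lower ones, with a
   leading coefficient that is nonzero at [p]. The lower derivatives, of order l < n, have contact k
   - l, at least k - n + 1. *)
elim=> [//|k IHk] i; rewrite ltnS leq_eqVlt => /predU1P[->|/IHk//].
have [lt_kn|le_nk] := ltnP k n; first exact: Fc_contact.
suff : contact p (k - n).+1 (iter n der Fc) by move/(_ (k - n)%N (ltnSn _));
  rewrite -iterD subnK.
apply: (contact_cancel cfn).
have -> : cf ord_max * iter n der Fc = \sum_l cf l * iter l der Fc
    - \sum_(l < n) cf (widen_ord (leqnSn n) l) * iter l der Fc.
  by rewrite big_ord_recr /= addrAC subrr add0r.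
apply: contactB; first exact: contact_vanish tC vR.
apply: contact_sum => l _; apply: contact_mul; apply: (@contactW _ (k - l)%N);
  last exact: contact_iter.
exact: ltn_sub2l (leq_trans (ltn_ord l) le_nk) (ltn_ord l).
Qed.

Section Drop.
Variables (n : nat) (E : 'I_n -> A).

Definition lincomb (c : 'rV[K]_n) : A := \sum_j c 0 j *: E j.

Definition jet k (v : 'rV[K]_4) : 'M[K]_(n, k) := \matrix_(j, i) (iter i der (E j)).@[v 0].

Lemma meval_iter_lincomb m i (C : 'M[K]_(m, n)) j v :
  (iter i der (lincomb (row j C))).@[v] = \sum_l C j l * (iter i der (E l)).@[v].
Proof.
rewrite iter_der_sum raddf_sum; apply: eq_bigr => l _ /=.
by rewrite iter_derZ mevalZ mxE.
Qed.

Lemma jetP k v (c : 'rV[K]_n) : contact v k (lincomb c) <-> c *m jet k v = 0.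
Proof.
have cE i : (iter i der (lincomb c)).@[v 0] = \sum_l c 0 l * (iter i der (E l)).@[v 0].
  by rewrite -meval_iter_lincomb row_id.
split=> [vc|/rowP c0 i lt_ik].
  apply/rowP => i; rewrite !mxE -[RHS](vc i) // cE.
  by apply: eq_bigr => l _; rewrite mxE.
have := c0 (Ordinal lt_ik); rewrite !mxE cE => c0i.
by rewrite -[RHS]c0i; apply: eq_bigr => l _; rewrite mxE.
Qed.

Hypothesis E_indep : forall c, vanish (lincomb c) -> c = 0.

Lemma lincomb_mul m (c : 'rV[K]_m) (C : 'M[K]_(m, n)) :
  \sum_j c 0 j *: lincomb (row j C) = lincomb (c *m C).
Proof.
rewrite /lincomb; under eq_bigr do rewrite scaler_sumr.
rewrite exchange_big; apply: eq_bigr => l _ /=.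
by rewrite mxE scaler_suml; apply: eq_bigr => j _; rewrite !mxE scalerA.
Qed.

(** The Wronskian of a basis of [S] is nonzero at a general point, so the derivatives of the basis
    of order below [\rank S] form an invertible matrix. Its first min(k, [\rank S]) columns are
    independent and occur in the jet matrix. *)
Lemma jet_rank_drop k (S : 'M[K]_n) : exists2 N : {poly K}, N != 0 &
  forall t u w, on_curve t u w -> N.[t] != 0 ->
    (\rank (S :&: kermx (jet k (curve_pt t u w)))%MS <= \rank S - k)%N.
Proof.
pose B := row_base S; pose F j := lincomb (row j B).
have F_indep (c : 'rV_(\rank S)) : vanish (\sum_j c 0 j *: F j) -> c = 0.
  rewrite lincomb_mul => /E_indep /eqP; rewrite mulmx_free_eq0 ?row_base_free //.
  by move/eqP.
have [|[N N0 [W' WW']]] := norm_cofactor (wronskian F).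
  by move=> /(wronskian_nonvanishing F_indep).
exists N => // t u w tC Nt; set p := curve_pt t u w; set Z := jet k p.
suff : (minn k (\rank S) <= \rank (S *m Z))%N.
  have := mxrank_mul_ker S Z.
  move: (\rank (S *m Z)) (\rank (S :&: _)%MS) (\rank S) => *; lia.
have Eb : \rank (S *m Z) = \rank (B *m Z) by rewrite (eqmxMr Z (eq_row_base S)).
pose W : 'M[K]_(\rank S) := \matrix_(i, j) (iter i der (F j)).@[p 0].
have W_unit : W^T \in unitmx.
  rewrite unitmx_tr unitmxE unitfE; apply: contraNneq Nt => W0.
  have EW : (wronskian F).@[p 0] = \det W.
    rewrite -[LHS](det_map_mx (meval (p 0))); congr (\det _).
    by apply/matrixP => i j; rewrite !mxE.
  by rewrite -(WW' _ _ _ tC) -/p EW W0 mul0r.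
set r := minn k (\rank S).
have rk : (r <= k)%N by apply: geq_minl.
have rS : (r <= \rank S)%N by apply: geq_minr.
have -> : r = \rank (W^T *m (pid_mx r : 'M_(\rank S, r))).
  by rewrite (eqmxMfull _) ?row_full_unit // rank_pid_mx.
(* Both sides list the derivatives of order below [r] of the basis [B]. *)
have -> : W^T *m (pid_mx r : 'M_(\rank S, r)) = B *m Z *m (pid_mx r : 'M_(k, r)).
  apply/matrixP => j i; rewrite !mxE (bigD1 (widen_ord rS i)) //= big1 => [|l li].
    rewrite (bigD1 (widen_ord rk i)) //= big1 => [|l li].
      rewrite !addr0 !mxE /= !eqxx !ltn_ord /= !mulr1 meval_iter_lincomb.
      by apply: eq_bigr => l _; rewrite !mxE.
    by rewrite [pid_mx _ _ _]mxE (_ : (l == i :> nat) = false) ?mulr0 //; apply/negbTE.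
  by rewrite [pid_mx _ _ _]mxE (_ : (l == i :> nat) = false) ?mulr0 //; apply/negbTE.
by rewrite Eb; apply: mxrankM_maxl.
Qed.

End Drop.

(** * A basis for the forms of degree d on the curve *)

(** The coefficients of the four components of a normal form are packed in one row. Its length is 4d
    for d > 0, hence 8k for forms of degree 2k. *)
Definition nf_of d (c : 'rV[K]_(d.+1 + d + (d + d.-1))) : A :=
  lift_poly (rVpoly (lsubmx (lsubmx c))) + lift_poly (rVpoly (rsubmx (lsubmx c))) * X2
  + lift_poly (rVpoly (lsubmx (rsubmx c))) * X3
  + lift_poly (rVpoly (rsubmx (rsubmx c))) * (X2 * X3).

Lemma lift_polyZ x (a : {poly K}) : lift_poly (x *: a) = x *: lift_poly a.
Proof. by rewrite /lift_poly map_polyZ hornerZ mul_mpolyC. Qed.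

Lemma nf_of_linear d x (c c' : 'rV[K]_(d.+1 + d + (d + d.-1))) :
  nf_of (x *: c + c') = x *: nf_of c + nf_of c'.
Proof.
by rewrite /nf_of !linearP /= !lift_polyD !lift_polyZ -!mul_mpolyC; ring.
Qed.

Definition chart_basis d (j : 'I_(d.+1 + d + (d + d.-1))) : A := nf_of (delta_mx 0 j).

Lemma lincomb_chart_basis d c : lincomb (@chart_basis d) c = nf_of c.
Proof.
have nf0 : nf_of (0 : 'rV_(d.+1 + d + (d + d.-1))) = 0.
  by have := nf_of_linear (-1) (0 : 'rV_(d.+1 + d + (d + d.-1))) 0;
     rewrite scaler0 addr0 scaleN1r addNr.
have nfZ x (c' : 'rV_(d.+1 + d + (d + d.-1))) : nf_of (x *: c') = x *: nf_of c'.
  by rewrite -[x *: c']addr0 nf_of_linear nf0 addr0.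
rewrite /lincomb [c in RHS]row_sum_delta (big_morph (@nf_of d) (id1 := 0) (op1 := +%R)) //.
- by apply: eq_bigr => j _; rewrite nfZ.
- by move=> c1 c2; rewrite -{1}[c1]scale1r nf_of_linear scale1r.
Qed.

Lemma chart_nf_lift_poly (a b c e : {poly K}) :
  chart_nf (lift_poly a + lift_poly b * X2 + lift_poly c * X3 + lift_poly e * (X2 *
    X3)) a b c e.
Proof.
move=> t u w tC; rewrite !derD !derM !der_lift_poly derX2 derX3 !(mevalD,
  mevalM) !meval_lift_poly.
by rewrite !mevalXU !mevalC !curve_ptE; split; ring.
Qed.

Lemma chart_basis_indep d c : vanish (lincomb (@chart_basis d) c) -> c = 0.
Proof.
rewrite lincomb_chart_basis => /(chart_nf_vanish (chart_nf_lift_poly _ _ _ _))[a0 b0 c0 e0].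
have rV0 n (v : 'rV[K]_n) : rVpoly v = 0 -> v = 0.
  by move=> v0; rewrite -[v]rVpolyK v0 linear0.
rewrite -[c]hsubmxK -[lsubmx c]hsubmxK -[rsubmx c]hsubmxK.
by rewrite (rV0 _ _ a0) (rV0 _ _ b0) (rV0 _ _ c0) (rV0 _ _ e0) !row_mx0.
Qed.

Lemma chart_basis_span d F : F \is d.-homog ->
  exists c, vanish (F - lincomb (@chart_basis d) c).
Proof.
move=> /(chart_nf_dhomog)[a [b [c [e [[sa sb sc se] nF]]]]].
exists (row_mx (row_mx (poly_rV a) (poly_rV b)) (row_mx (poly_rV c) (poly_rV e))).
move=> t u w tC; rewrite lincomb_chart_basis /nf_of !(row_mxKl, row_mxKr) !poly_rV_K //.
rewrite mevalB; have [-> _] := nF _ _ _ tC.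
by have [-> _] := chart_nf_lift_poly a b c e tC; rewrite subrr.
Qed.

(** * Choice of general points *)

Definition setrow r (P : 'M[K]_(r, 4)) j (x : 'rV[K]_4) : 'M[K]_(r, 4) :=
  \matrix_(i, l) if i == j then x 0 l else P i l.

Lemma row_setrow r (P : 'M[K]_(r, 4)) j x i :
  row i (setrow P j x) = if i == j then x else row i P.
Proof. by apply/rowP => l; rewrite !mxE; case: eqP => // _; rewrite !mxE. Qed.

Lemma setrow_row r (P : 'M[K]_(r, 4)) j : setrow P j (row j P) = P.
Proof. by apply/row_matrixP => i; rewrite row_setrow; case: eqP => [->|]. Qed.

Lemma generic_forall (R : nat -> K -> K -> K -> Prop) m :
  (forall k, (k < m)%N -> exists2 N : {poly K}, N != 0 &
    forall t u w, on_curve t u w -> N.[t] != 0 -> R k t u w) ->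
  exists2 N : {poly K}, N != 0 &
    forall t u w, on_curve t u w -> N.[t] != 0 -> forall k, (k < m)%N -> R k t u w.
Proof.
elim: m => [|m IH] RN; first by exists 1; rewrite ?oner_eq0.
have [|N1 N10 N1R] := IH; first by move=> k lt_km; apply/RN/leqW.
have [N2 N20 N2R] := RN m (ltnSn m).
exists (N1 * N2); first by rewrite mulf_neq0.
move=> t u w tC; rewrite hornerM mulf_eq0 negb_or => /andP[t1 t2] k.
by rewrite ltnS leq_eqVlt => /predU1P[->|]; [apply: N2R|apply: N1R].
Qed.

(** [G] stands for an arbitrary open condition that holds somewhere on the curve, at [P0]. The rows
    of [P0] are replaced one at a time by general points, keeping [G] nonzero. Each new point lowers
    the system of degree 2k by k until it is zero, so 8 points exhaust a dimension of 8k for every k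
    at once. *)
Lemma general_points r m (G : 'M[K]_(r, 4) -> K) (P0 : 'M[K]_(r, 4)) :
  (8 <= r)%N ->
  (forall P j, exists d F, F \is d.-homog /\ forall x, G (setrow P j x) = F.@[x 0]) ->
  (forall i, q1.@[row i P0 0] = 0 /\ q2.@[row i P0 0] = 0) -> G P0 != 0 ->
  exists P, [/\ G P != 0,
    forall i, exists t u w, [/\ on_curve t u w, u * w != 0 & row i P = curve_pt t u w] &
    forall k F, (0 < k <= m)%N -> F \is (2 * k).-homog ->
      (forall i, contact (row i P) k F) -> vanish F].
Proof.
move=> r_ge8 GF P0C GP0.
pose chart (P : 'M[K]_(r, 4)) i :=
  exists t u w, [/\ on_curve t u w, u * w != 0 & row i P = curve_pt t u w].
pose n_ k := ((2 * k).+1 + 2 * k + (2 * k + (2 * k).-1))%N.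
pose E k : 'I_(n_ k) -> A := @chart_basis (2 * k).
have E_indep k c : vanish (lincomb (E k) c) -> c = 0 by apply: chart_basis_indep.
(* Invariant after [j] replacements: the forms of degree 2(k + 1) on the curve with contact k + 1 at
   the first [j] points lie in a space [S] of dimension at most (8 - j)(k + 1), with truncated
   subtraction. *)
suff /(_ r (leqnn r)) [P [PC Pchart GP PS]] : forall j, (j <= r)%N ->
    exists P : 'M[K]_(r, 4), [/\ forall i, q1.@[row i P 0] = 0 /\ q2.@[row i P 0] = 0,
      forall i : 'I_r, (i < j)%N -> chart P i, G P != 0 &
      forall k, (k < m)%N -> exists2 S : 'M[K]_(n_ k.+1), (\rank S <= (8 - j) * k.+1)%N &
        forall c : 'rV[K]_(n_ k.+1), (forall i : 'I_r, (i < j)%N ->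
          c *m jet (E k.+1) k.+1 (row i P) = 0)
          -> (c <= S)%MS].
  exists P; split=> // [i|[//|k] F le_km Fd Fcontact]; first exact: Pchart.
  have [c vFc] := chart_basis_span Fd.
  have [S rS cS] := PS k le_km.
  have S0 : S = 0 by apply/eqP; rewrite -mxrank_eq0; move: rS; lia.
  have c0 : c = 0.
    apply/eqP; rewrite -submx0 -S0; apply: cS => i lt_ir; apply/jetP.
    have [t [u [w [tC _ EP]]]] := Pchart i lt_ir.
    rewrite -[lincomb _ _](subKr F); apply: contactB => //.
    rewrite EP.
    exact: (contact_vanish tC vFc).
  move=> t u w tC; rewrite -(vFc _ _ _ tC) mevalB c0 lincomb_chart_basis.
  by rewrite -lincomb_chart_basis /lincomb big1 ?meval0 ?subr0 // => j _;
    rewrite mxE scale0r.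
elim=> [_|j IH lt_jr].
  exists P0; split=> // k lt_km; exists 1%:M => [|c _]; last exact: submx1.
  by rewrite mxrank1 /n_; lia.
have [P [PC Pchart GP PS]] := IH (ltnW lt_jr); pose oj := Ordinal lt_jr.
have [d [F [Fd FG]]] := GF P oj.
have [vF|[N N0 [F' FF']]] := norm_cofactor F.
  (* The row to be replaced may lie outside the chart, so the vanishing of [F] is carried to it by
     membership in the ideal of the two quadrics. *)
  have [G1 [H1 [_ _ EF]]] := vanish_dhomog Fd vF.
  case/eqP: GP; rewrite -(setrow_row P oj) FG EF; have [Q1 Q2] := PC oj.
  by rewrite mevalD !mevalM Q1 Q2 !mul0r addr0.
pose R k (t u w : K) := exists2 S : 'M[K]_(n_ k.+1), (\rank S <= (8 - j.+1) * k.+1)%N &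
  forall c : 'rV[K]_(n_ k.+1), (forall i : 'I_r, (i < j)%N ->
    c *m jet (E k.+1) k.+1 (row i P) = 0) ->
    c *m jet (E k.+1) k.+1 (curve_pt t u w) = 0 -> (c <= S)%MS.
have [|N' N'0 NR] := @generic_forall R m.
  move=> k lt_km; have [S rS cS] := PS k lt_km.
  have [N' N'0 NS] := jet_rank_drop
    (E_indep k.+1) k.+1 S.
  exists N' => // t u w tC Nt; exists (S :&: kermx (jet (E k.+1) k.+1 (curve_pt t u
    w)))%MS; last first.
    by move=> c cP /sub_kermxP cp; rewrite sub_capmx cS.
  apply: leq_trans (NS _ _ _ tC Nt) _.
  by rewrite -[j.+1]addn1 subnDA mulnBl mul1n leq_sub2r.
have NN : N * N' != 0 by rewrite mulf_neq0.
have [t [u [w [tC uw0]]]] := generic_point NN.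
rewrite hornerM mulf_eq0 negb_or => /andP[Nt N't].
exists (setrow P oj (curve_pt t u w)); split.
- by move=> i; rewrite row_setrow; case: eqP => [_|//]; apply: on_curve_q.
- move=> i; rewrite ltnS /chart row_setrow; case: eqP => [_ _|/eqP ij le_ij];
    first by exists t, u, w.
  by apply: Pchart; rewrite ltn_neqAle le_ij andbT.
- by rewrite FG; apply: contraNneq Nt => F0; rewrite -(FF' _ _ _ tC) F0 mul0r.
move=> k lt_km; have [S rS cS] := NR _ _ _ tC N't _ lt_km; exists S => // c cP; apply: cS.
  move=> i lt_ij; rewrite -(cP i (ltnW lt_ij)) row_setrow; case: eqP lt_ij => // ->.
  by rewrite ltnn.
by rewrite -[RHS](cP oj (ltnSn j)) row_setrow eqxx.
Qed.

(** * Descent through the powers of the ideal of the curve *)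

Lemma mderiv_exp (F : A) i k : (F ^+ k.+1)^`M(i) = (F ^+ k * F^`M(i)) *+ k.+1.
Proof.
elim: k => [|k IH]; first by rewrite expr1 expr0 mul1r.
by rewrite exprS mderivM IH [RHS]mulrS (exprS F k); ring.
Qed.

Lemma mderiv_sum i (I : Type) (s : seq I) (P : pred I) (f : I -> A) :
  (\sum_(j <- s | P j) f j)^`M(i) = \sum_(j <- s | P j) (f j)^`M(i).
Proof. exact: raddf_sum. Qed.

Definition qcomb j (F_ : nat -> A) : A := \sum_(a < j.+1) q1 ^+ a * q2 ^+ (j - a) * F_ a.

(** [q1] does not involve X3, so only the powers of [q2] drop. Modulo the ideal of the curve, the
    coefficients with index at most j survive, multiplied by X3 and a positive integer. *)
Lemma qcomb_mderiv3 j F_ : (qcomb j.+1 F_)^`M(o3) =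
  qcomb j (fun a => ((j - a).+1)%:R * (2%:R * X3) * F_ a + q2 * (F_ a)^`M(o3)
                    + (if a == j then q1 * (F_ j.+1)^`M(o3) else 0)).
Proof.
have dq1 : q1^`M(o3) = 0.
  rewrite /q1 !expr2 !(mderivB, mderivD, mderivZ, mderivM) !mderivXU /=.
  by rewrite ?(mulr0, mul0r, addr0, scaler0, subr0).
have dq2 : q2^`M(o3) = 2%:R * X3.
  rewrite /q2 !expr2 !(mderivB, mderivD, mderivZ, mderivM) !mderivXU /=.
  by rewrite ?(mulr0, mul0r, addr0, scaler0, subr0); ring.
rewrite /qcomb mderiv_sum big_ord_recr /= subnn expr0 mulr1.
have dq1n n : (q1 ^+ n)^`M(o3) = 0.
  by case: n => [|n]; rewrite ?expr0 -?mpolyC1 ?mderivC // mderiv_exp dq1 mulr0 mul0rn.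
under [RHS]eq_bigr do rewrite mulrDr.
rewrite big_split; congr (_ + _).
  apply: eq_bigr => a _; rewrite !mderivM dq1n subSn -1?ltnS // mderiv_exp dq2.
  by rewrite (exprS q2); ring.
rewrite big_ord_recr big1 /= => [|a _]; last by rewrite ltn_eqF ?mulr0.
by rewrite eqxx subnn expr0 mderivM dq1n exprSr; ring.
Qed.

(** Here the powers of [q1] drop and the index shifts by one, which recovers the last coefficient,
    lost under differentiation along X3. *)
Lemma qcomb_mderiv2 j F_ : (qcomb j.+1 F_)^`M(o2) =
  qcomb j (fun a => (a.+1)%:R * (2%:R * X2) * F_ a.+1 + q1 * (F_ a.+1)^`M(o2)
                    + (if a == 0%N then q2 * (F_ 0%N)^`M(o2) else 0)).
Proof.
have dq2 : q2^`M(o2) = 0.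
  rewrite /q2 !expr2 !(mderivB, mderivD, mderivZ, mderivM) !mderivXU /=.
  by rewrite ?(mulr0, mul0r, addr0, scaler0, subr0).
have dq1 : q1^`M(o2) = 2%:R * X2.
  rewrite /q1 !expr2 !(mderivB, mderivD, mderivZ, mderivM) !mderivXU /=.
  by rewrite ?(mulr0, mul0r, addr0, scaler0, subr0); ring.
rewrite /qcomb mderiv_sum big_ord_recl /= subn0 expr0 mul1r.
have dq2n n : (q2 ^+ n)^`M(o2) = 0.
  by case: n => [|n]; rewrite ?expr0 -?mpolyC1 ?mderivC // mderiv_exp dq2 mulr0 mul0rn.
under [RHS]eq_bigr do rewrite mulrDr.
rewrite big_split addrC; congr (_ + _).
  apply: eq_bigr => a _; rewrite /bump /= add1n subSS !mderivM dq2n mderiv_exp dq1.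
  by rewrite (exprS q1); ring.
rewrite big_ord_recl big1 /= => [|a _]; last by rewrite mulr0.
by rewrite subn0 expr0 mderivM dq2n exprSr; ring.
Qed.

(** Each derivative lowers both [M] and [j] by one. The one along X2 serves for the top coefficient
    and the one along X3 for the others; X2 and X3 do not vanish at the point. *)
Lemma qcomb_contact t u w j F_ M : on_curve t u w -> u * w != 0 -> (j <= M)%N ->
  mult_ge (curve_pt t u w) M (qcomb j F_) ->
  forall a, (a <= j)%N -> contact (curve_pt t u w) (M - j) (F_ a).
Proof.
move=> tC uw0; have [u0 w0] : u != 0 /\ w != 0.
  by move: uw0; rewrite mulf_eq0 negb_or => /andP.
have natf0 n : (n.+1)%:R != 0 :> K by move/pcharf0P: charK0 => ->.
have vI G H k : contact (curve_pt t u w) k (q1 * G + q2 * H).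
  apply: (contact_vanish tC).
  by move=> t' u' w' t'C; case: (vanish_ideal G H t'C).
(* The remainder [R] lies in the ideal of the curve and so has contact of every order; the factor in
   front of [F] is nonzero at the point and can be cancelled. *)
have contact_lead k n X F R G H : X.@[curve_pt t u w 0] != 0 ->
    R = q1 * G + q2 * H -> contact (curve_pt t u w) k (n.+1%:R * (2%:R * X) * F + R) ->
    contact (curve_pt t u w) k F.
  move=> X0 -> Fcontact; apply: (contact_cancel (F := n.+1%:R * (2%:R * X))).
    by rewrite !mevalM !rmorph_nat !mulf_neq0.
  rewrite -[_ * F](addrK (q1 * G + q2 * H)).
  by apply: contactB.
elim: j F_ M => [|j IH] F_ [|M] // le_jM.
  by rewrite /qcomb big_ord1 !expr0 !mul1r => /mult_ge_contact Fcontact [|a].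
move=> mF a; rewrite leq_eqVlt => /predU1P[->|lt_aj].
  have /(mult_ge_mderiv o2) := mF;
    rewrite qcomb_mderiv2 => /(IH _ _ le_jM) /(_ j (leqnn j)).
  rewrite -addrA; set R := _ + (if _ then _ else _).
  apply: (@contact_lead _ j X2 _ R (F_ j.+1)^`M(o2) (if j == 0%N then (F_ 0%N)^`M(o2)
    else 0)).
    by rewrite mevalXU curve_ptE.
  by rewrite /R; case: eqP; rewrite ?mulr0.
have /(mult_ge_mderiv o3) := mF; rewrite qcomb_mderiv3 => /(IH _ _ le_jM) /(_ a lt_aj).
rewrite -addrA; set R := _ + (if _ then _ else _).
apply: (@contact_lead _ (j - a)%N X3 _ R (if a == j then (F_ j.+1)^`M(o3) else 0) (F_
  a)^`M(o3)).
  by rewrite mevalXU curve_ptE.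
by rewrite /R addrC; case: eqP; rewrite ?mulr0.
Qed.

Lemma dhomog0_const (F : A) : F \is 0.-homog -> F = (F@_0)%:MP.
Proof.
move=> F0; apply/mpolyP => mu; rewrite mcoeffC; case: eqP => [->|/eqP mu0].
  by rewrite mulr1.
by rewrite mulr0 (dhomog_nemf_coeff F0) //= mdeg_eq0.
Qed.

Lemma dhomog_cohomog d (G : A) : cohomog d.+2 G = (G \is d.-homog).
Proof. by []. Qed.

Lemma mult_ge_qcomb r m (P : 'M[K]_(r, 4)) F :
  (forall i, exists t u w, [/\ on_curve t u w, u * w != 0 & row i P = curve_pt t u w]) ->
  (forall k F, (0 < k <= m)%N -> F \is (2 * k).-homog ->
      (forall i, contact (row i P) k F) -> vanish F) ->
  F \is (2 * m).-homog -> (forall i, mult_ge (row i P) m F) ->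
  exists c : nat -> K, F = \sum_(a < m.+1) c a *: (q1 ^+ a * q2 ^+ (m - a)).
Proof.
move=> Pchart Pgen Fd mF.
suff /(_ m (leqnn m)) [F_ F_d EF] : forall j, (j <= m)%N -> exists2 F_ : nat -> A,
    forall a, (a <= j)%N -> F_ a \is (2 * (m - j)).-homog & F = qcomb j F_.
  exists (fun a => (F_ a)@_0); rewrite EF; apply: eq_bigr => a _.
  have := F_d a; rewrite subnn muln0 => /(_ (ltn_ord a))/dhomog0_const{1}->.
  by rewrite mulrC mul_mpolyC.
elim=> [_|j IH lt_jm].
  exists (fun=> F) => [a _|]; first by rewrite subn0.
  by rewrite /qcomb big_ord1 !expr0 !mul1r.
have [F_ F_d EF] := IH (ltnW lt_jm).
have /fin_all_exists[G /fin_all_exists[H GH]] (a : 'I_j.+1) : exists G H,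
    [/\ G \is (2 * (m - j.+1)).-homog, H \is (2 * (m - j.+1)).-homog &
      F_ a = q1 * G + q2 * H].
  have le_aj : (a <= j)%N by rewrite -ltnS.
  have vFa : vanish (F_ a).
    apply: (Pgen (m - j)%N _ _ (F_d a le_aj)); first by rewrite subn_gt0 lt_jm leq_subr.
    move=> i; have [t [u [w [tC uw0 EP]]]] := Pchart i; rewrite EP.
    by apply: qcomb_contact => //; [apply: ltnW | rewrite -EF -EP].
  have [G [H [cG cH ->]]] := vanish_dhomog (F_d a le_aj) vFa.
  have Emj : (2 * (m - j) = (2 * (m - j.+1)).+2)%N by lia.
  by exists G, H; split=> //; rewrite -dhomog_cohomog -Emj.
(* The coefficient of index b collects the cofactor of [q1] from index b - 1 and that of [q2] from
   index b; the first is missing for b = 0 and the second for b = j + 1. *)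
exists (fun b => (if b is b'.+1 then G (inord b') else 0)
                 + (if (b <= j)%N then H (inord b) else 0)) => [[|b] le_bj|].
- by rewrite add0r; case: (GH (inord 0)).
- apply: rpredD; first by case: (GH (inord b)).
  by case: ifP => _; [case: (GH (inord b.+1)) | apply: rpred0].
rewrite EF /qcomb; under [RHS]eq_bigr do rewrite mulrDr.
rewrite [RHS]big_split /= [X in X + _]big_ord_recl [X in _ + X]big_ord_recr /=.
rewrite ltnn !mulr0 add0r addr0 -big_split; apply: eq_bigr => a _ /=.
have le_aj : (a <= j)%N by rewrite -ltnS.
rewrite /bump add1n subSS le_aj inord_val; case: (GH a) => _ _ ->.
by rewrite subSn // (exprS q2) (exprS q1); ring.
Qed.

End Curve.

(** * Semicontinuity *)

Section Openness.
Variables (K : fieldType) (charK0 : [pchar K] =i pred0) (r : nat).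
Local Notation A := {mpoly K[4]}.
Local Notation B := {mpoly K[r * 4]}.

(** In characteristic 0 Taylor coefficients are derivatives divided by factorials. Derivatives of a
    form are forms in the point, so minors built from these conditions are multihomogeneous. *)
Lemma mult_ge_mderivm (v : 'rV[K]_4) k F :
  mult_ge v k F <-> forall mu : 'X_{1..4}, (mdeg mu < k)%N -> F^`M[mu].@[v 0] = 0.
Proof.
have taylor_mderivm mu G : taylor v G^`M[mu] = (taylor v G)^`M[mu].
  move Ed: (mdeg mu) => d; elim: d mu Ed G => [|d IH] mu Ed G.
    by move/eqP: Ed; rewrite mdeg_eq0 => /eqP->; rewrite !mderivm0m.
  have [i mi] : exists i, mu i != 0%N by apply: mnm_neq0P; rewrite -mdeg_eq0 Ed.
  have Emu : mu = (mu - U_(i) + U_(i))%MM by rewrite submK // lep1mP.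
  rewrite Emu !mderivmDm !mderivmU1m taylor_mderiv IH //.
  by move: Ed; rewrite {1}Emu mdegD mdeg1; lia.
have E mu : F^`M[mu].@[v 0] = (taylor v F)@_mu *+ \prod_(i < 4) (mu i)`!.
  rewrite -taylor_mcoeff0 taylor_mderivm mcoeff_mderivm addm0.
  by congr (_ *+ _); apply: eq_bigr => i _; rewrite ffactnn.
split=> vF mu lt_mu; first by rewrite E vF ?mul0rn.
have /eqP := vF mu lt_mu; rewrite E -mulr_natr mulf_eq0 => /orP[/eqP//|].
move/pcharf0P: charK0 => ->; rewrite -leqn0 leqNgt.
by rewrite prodn_gt0 // => i; apply: fact_gt0.
Qed.

Lemma dhomog_mderivm d F (mu : 'X_{1..4}) :
  F \is d.-homog -> (F^`M[mu] : A) \is (d - mdeg mu).-homog.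
Proof.
move=> Fd; apply/dhomogP => nu; rewrite mcoeff_msupp mcoeff_mderivm => nu0 /=.
apply/eqP; apply: contraNT nu0 => nud.
rewrite (dhomog_nemf_coeff Fd) ?mul0rn //= mdegD.
by apply: contraNneq nud => <-; rewrite addKn.
Qed.

Definition multideg (e : 'I_r -> nat) (G : B) : Prop := forall mu, mu \in msupp G ->
  forall i, (\sum_(l < 4) mu (mxvec_index i l))%N = e i.

Lemma multidegC c : multideg (fun=> 0%N) c%:MP.
Proof.
move=> mu; rewrite msuppC; case: eqP => // _; rewrite inE => /eqP-> i.
by rewrite big1 // => l _; rewrite mnm0E.
Qed.

Lemma multidegM e e' G H : multideg e G -> multideg e' H ->
  multideg (fun i => e i + e' i)%N (G * H).
Proof.
move=> eG eH mu /msuppM_le /allpairsP[[m1 m2] /= [m1G m2H ->]] i.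
by rewrite -(eG _ m1G) -(eH _ m2H) -big_split; apply: eq_bigr => l _; rewrite mnmDE.
Qed.

Lemma multidegD e G H : multideg e G -> multideg e H -> multideg e (G + H).
Proof.
by move=> eG eH mu /msuppD_le; rewrite mem_cat => /orP[/eG|/eH].
Qed.

Lemma multideg_eq e e' G : multideg e G -> e =1 e' -> multideg e' G.
Proof. by move=> eG ee' mu /eG muE i; rewrite muE. Qed.

Lemma multidegZ e c G : multideg e G -> multideg e (c *: G).
Proof. by move=> eG mu /msuppZ_le/eG. Qed.

Lemma multideg_sum e (I : Type) (s : seq I) (P : pred I) (f : I -> B) :
  (forall i, P i -> multideg e (f i)) -> multideg e (\sum_(i <- s | P i) f i).
Proof.
move=> ef; elim/big_ind: _ => [mu|G H|i Pi]; [|exact: multidegD|exact: ef].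
by rewrite -mpolyC0 msupp0.
Qed.

Lemma multideg_prod (I : Type) (s : seq I) (f : I -> B) (e : I -> 'I_r -> nat) :
  (forall i, multideg (e i) (f i)) ->
  multideg (fun j => \sum_(i <- s) e i j)%N (\prod_(i <- s) f i).
Proof.
move=> ef; elim: s => [|i s IH].
  by rewrite big_nil -mpolyC1; refine (multideg_eq (@multidegC 1) _) => j; rewrite big_nil.
rewrite big_cons; refine (multideg_eq (multidegM (ef i) IH) _) => j.
by rewrite big_cons.
Qed.

Lemma mxvec_index_eq i i' l l' :
  (@mxvec_index r 4 i l == mxvec_index i' l') = (i == i') && (l == l').
Proof.
have [g gK _] := @curry_mxvec_bij r 4; rewrite -xpair_eqE.
apply/eqP/eqP => [E|[-> ->] //].
by rewrite -(gK (i, l)) //= E (gK (i', l')).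
Qed.

Lemma multidegXn i l k : multideg (fun i' => (i' == i) * k)%N ('X_(mxvec_index i l) ^+ k).
Proof.
elim: k => [|k IH].
  by rewrite expr0 -mpolyC1; refine (multideg_eq (@multidegC 1) _) => j; rewrite muln0.
rewrite exprS; apply: (@multideg_eq (fun i' => (i' == i) + (i' == i) * k)%N); last first.
  by move=> j; rewrite mulnS.
apply: multidegM IH => mu; rewrite msuppX inE => /eqP-> i'.
under eq_bigr do rewrite mnm1E mxvec_index_eq [i == i']eq_sym.
case: eqP => _ /=; last by rewrite big1.
by rewrite (bigD1 l) //= eqxx big1 // => l' /negPf; rewrite eq_sym => ->.
Qed.

Definition at_pt (i : 'I_r) (g : A) : B := g \mPo [tuple 'X_(mxvec_index i l) | l < 4].

Lemma meval_at_pt i g (P : 'M[K]_(r, 4)) : meval_pts (at_pt i g) P = g.@[row i P 0].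
Proof.
rewrite /meval_pts comp_mpoly_meval; apply: meval_eq => l.
by rewrite tnth_mktuple mevalXU mxvecE mxE.
Qed.

Lemma multideg_at_pt i d g : g \is d.-homog ->
  multideg (fun i' => (i' == i) * d)%N (at_pt i g).
Proof.
move=> /dhomogP gd; rewrite /at_pt comp_mpolyEX big_seq;
  apply: multideg_sum => nu /gd /= <-.
apply: multidegZ; rewrite comp_mpolyX.
have := @multideg_prod _ (index_enum 'I_4) (fun l => 'X_(mxvec_index i l) ^+ nu l)
  (fun l i' => (i' == i) * nu l)%N (fun l => @multidegXn i l (nu l)).
under [X in multideg _ X -> _]eq_bigr => l _ do rewrite -(tnth_mktuple (fun l =>
  'X_(mxvec_index i l)) l).
by move=> /multideg_eq; apply=> i'; rewrite mdegE big_distrr.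
Qed.

Lemma multideg_det s (h : 'I_s -> 'I_s -> B) (e : 'I_s -> 'I_r -> nat) :
  (forall a b, multideg (e b) (h a b)) ->
  multideg (fun i => \sum_b e b i)%N (\det (\matrix_(a, b) h a b)).
Proof.
move=> eh; apply: multideg_sum => sg _.
rewrite mulr_sign -[if _ then _ else _]scale1r.
have prodE : multideg (fun i => \sum_b e b i)%N
    (\prod_a (\matrix_(a, b) h a b) a (sg a)).
  have := @multideg_prod _ (index_enum 'I_s) (fun a => h a (sg a)) (fun a => e (sg a))
    (fun a => eh a (sg a)).
  under [X in multideg _ X -> _]eq_bigr => a _ do rewrite -[h a (sg a)](mxE matrix_key
    (fun a b => h a b)).
  by move=> /multideg_eq; apply=> i; rewrite [RHS](reindex_inj (@perm_inj _ sg)).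
apply: multidegZ; case: ifP => _ //.
by rewrite -scaleN1r; apply: multidegZ.
Qed.

Lemma multihomogeneous_multideg e G : multideg e G -> multihomogeneous G.
Proof. by exists e. Qed.

(* [G] is a minor, nonzero at [P], of the matrix of the conditions restricted to
   a complement of the system at [P]. *)
Lemma linear_system_semicontinuous d m (P : 'M[K]_(r, 4)) :
  exists G, [/\ multihomogeneous G, meval_pts G P != 0 &
    forall P', meval_pts G P' != 0 ->
      (\dim (linear_system d (fun=> m) P') <= \dim (linear_system d (fun=> m) P))%N].
Proof.
pose L (P' : 'M[K]_(r, 4)) := linear_system d (fun _ : 'I_r => m) P'.
pose C := ((L P)^C)%VS; pose b := vbasis C; pose s := \dim C.
pose J : finType := ('I_r * 'X_{1..4 < m})%type.
pose g (a : 'I_s) (t : J) : A := (b`_a : A)^`M[t.2].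
pose Psi (P' : 'M[K]_(r, 4)) : 'M[K]_(s, #|J|) :=
  \matrix_(a, t) (g a (enum_val t)).@[row (enum_val t).1 P' 0].
pose comb (c : 'rV[K]_s) : dhomog 4 K d := \sum_a c 0 a *: b`_a.
have PsiE c P' t : (c *m Psi P') 0 t =
    ((comb c : A)^`M[(enum_val t).2]).@[row (enum_val t).1 P' 0].
  rewrite mxE /comb !raddf_sum; apply: eq_bigr => a _ /=.
  by rewrite mxE linearZ mevalZ.
have combL c P' : comb c \in L P' <-> c *m Psi P' = 0.
  rewrite linear_systemP; split=> [cL|cP i].
    apply/rowP => t; rewrite PsiE mxE.
    by have /mult_ge_mderivm := cL (enum_val t).1; apply; apply: bmdeg.
  apply/mult_ge_mderivm => mu lt_mu.
  have /rowP/(_ (enum_rank (i, BMultinom lt_mu))) := cP.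
  by rewrite PsiE enum_rankK mxE.
have comb_inj c : comb c = 0 -> c = 0.
  move=> c0; apply/rowP => a; rewrite mxE.
  by have /freeP/(_ (c 0) c0 a) := basis_free (vbasisP C).
have combC c : comb c \in C.
  by apply: memv_suml => a _; apply: memvZ; apply: vbasis_mem; rewrite mem_nth ?size_tuple.
have Psi_free : row_free (Psi P).
  apply: inj_row_free => c /combL cL; apply: comb_inj; apply/eqP.
  by rewrite -memv0 -(capv_compl (L P)) memv_cap cL combC.
have PsiT_full : row_full (Psi P)^T by rewrite /row_full mxrank_tr.
(* Only zero in [C] lies in [L P], so the conditions at [P] have rank [s] on [C]; [f] picks [s]
   independent ones. *)
pose f := fullrankfun PsiT_full.
pose G : B := \det (\matrix_(a, k) at_pt (enum_val (f k)).1 (g a (enum_val (f k)))).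
have GE P' : meval_pts G P' = \det (colsub f (Psi P')).
  rewrite /meval_pts -[LHS](det_map_mx (meval (mxvec P' 0))); congr (\det _).
  by apply/matrixP => a k; rewrite !mxE -meval_at_pt.
exists G; split.
- refine (multihomogeneous_multideg (multideg_det
    (e := fun k i => ((i == (enum_val (f k)).1) * (d - mdeg (enum_val (f k)).2))%N) _))
      => a k.
  exact: (@multideg_at_pt _ _ _ (dhomog_mderivm _ (dhomog_is_dhomog _))).
- rewrite GE -unitfE -unitmxE -unitmx_tr.
  have -> : (colsub f (Psi P))^T = rowsub f (Psi P)^T by apply/matrixP => a k; rewrite !mxE.
  exact: fullrowsub_unit.
move=> P'; rewrite GE => GP'; rewrite -/(L P') -/(L P).
(* The chosen conditions stay independent on [C] at [P'], so [L P'] meets [C] trivially and has at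
   most the codimension of [C], which is [\dim (L P)]. *)
have CL0 : (L P' :&: C = 0)%VS.
  apply/eqP; rewrite -subv0; apply/subvP => F; rewrite memv_cap => /andP[FL FC].
  pose c : 'rV[K]_s := \row_a coord b a F.
  have EF : F = comb c.
    by rewrite {1}(coord_vbasis FC); apply: eq_bigr => a _; rewrite mxE.
  rewrite EF in FL *; have /combL cP := FL.
  suff -> : c = 0 by rewrite /comb big1 ?mem0v // => a _; rewrite mxE scale0r.
  have : c *m colsub f (Psi P') = 0.
    apply/rowP => k; have /rowP/(_ (f k)) := cP; rewrite !mxE => cfk; rewrite -[RHS]cfk.
    by apply: eq_bigr => a _; rewrite !mxE.
  move/eqP; rewrite mulmx_free_eq0 ?row_free_unit ?unitmxE ?unitfE //.
  by move/eqP.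
have := dimv_disjoint_sum CL0; have := dimvS (subvf (L P' + C)%VS).
have := dimv_compl (L P); have := dimvS (subvf (L P)); rewrite -/C.
by move=> *; lia.
Qed.

End Openness.

(** * Diagonalization of the pencil *)

Section QuadraticForms.
Variables (K : fieldType) (n : nat).
Implicit Types (F : {mpoly K[n.+1]}) (v : 'rV[K]_n.+1).

Lemma euler d F : F \is d.-homog -> \sum_j 'X_j * F^`M(j) = d%:R *: F.
Proof.
move=> /dhomogP Fd; rewrite [F]mpolyE; under eq_bigr do rewrite raddf_sum mulr_sumr.
rewrite exchange_big scaler_sumr big_seq [RHS]big_seq; apply: eq_bigr => m /Fd <- /=.
transitivity (\sum_j (F@_m * (m j)%:R) *: ('X_[m] : {mpoly K[n.+1]})).
  apply: eq_bigr => j _; rewrite mderivZ mderivX scalerA -scalerAr.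
  have [->|mj] := eqVneq (m j) 0%N; first by rewrite mulr0 !scale0r.
  by rewrite -mpolyXD addmC submK // lep1mP.
by rewrite -scaler_suml -mulr_sumr -natr_sum -mdegE scalerA mulrC.
Qed.

Lemma dhomog1_linear F v : F \is 1.-homog -> F.@[v 0] = \sum_j v 0 j * F@_U_(j).
Proof.
move=> F1; have := euler F1; rewrite scale1r => {1}<-.
rewrite raddf_sum; apply: eq_bigr => j _ /=; rewrite mevalM mevalXU; congr (_ * _).
have -> : F^`M(j) = (F@_U_(j))%:MP; last by rewrite mevalC.
apply/mpolyP => mu; rewrite mcoeff_deriv mcoeffC.
have [->|mu0] := eqVneq mu 0%MM; first by rewrite add0m mnm0E mulr1n mulr1.
rewrite mulr0 (dhomog_nemf_coeff F1) ?mul0rn //= mdegD mdeg1 addn1 eqSS.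
by rewrite mdeg_eq0.
Qed.

Lemma dhomog_mderiv d F j : F \is d.+1.-homog -> F^`M(j) \is d.-homog.
Proof.
move=> Fd; apply/dhomogP => mu; rewrite mcoeff_msupp mcoeff_deriv => mu0 /=.
apply/eqP; rewrite -eqSS -addn1 -(mdeg1 j) -mdegD; apply: contraNT mu0 => mud.
by rewrite (dhomog_nemf_coeff Fd) // mul0rn.
Qed.

(** [S] is the matrix of second derivatives, and the last identity is Euler's relation. *)
Lemma hessian q : q \is 2.-homog -> exists S : 'M[K]_n.+1, [/\ S^T = S,
  forall v j, (q^`M(j)).@[v 0] = (v *m S) 0 j &
  forall v, 2%:R * q.@[v 0] = (v *m S *m v^T) 0 0].
Proof.
move=> q2; pose S := \matrix_(i, j) (q^`M(j))@_U_(i) : 'M[K]_n.+1.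
have gradE v j : (q^`M(j)).@[v 0] = (v *m S) 0 j.
  rewrite dhomog1_linear ?dhomog_mderiv // mxE.
  by apply: eq_bigr => i _; rewrite mxE.
exists S; split=> // [|v].
  apply/matrixP => i j; rewrite !mxE !mcoeff_deriv addmC.
  by rewrite !mnm1E eq_sym.
have := congr1 (meval (v 0)) (euler q2); rewrite mevalZ => <-.
rewrite raddf_sum mxE; apply: eq_bigr => j _ /=.
by rewrite mevalM mevalXU gradE [v^T _ _]mxE mulrC.
Qed.

End QuadraticForms.

Section Pencil.
Variables (K : closedFieldType) (n : nat).
Implicit Types (S T P : 'M[K]_n.+1) (v : 'rV[K]_n.+1).

Lemma not_uniq_perm (T : eqType) (s : seq T) :
  ~~ uniq s -> exists z s', perm_eq s [:: z, z & s'].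
Proof.
elim: s => //= x s IH; rewrite negb_and negbK.
have [xs _|_ /= /IH[z [s' ss']]] := boolP (x \in s).
  by exists x, (rem x s); rewrite perm_cons perm_to_rem.
exists z, (x :: s'); rewrite -(perm_cons x) in ss'; apply: perm_trans ss' _.
by rewrite -[_ :: _]/([:: x] ++ [:: z; z] ++ s') -[X in perm_eq _ X]/([:: z;
  z] ++ [:: x] ++ s') perm_catCA.
Qed.

(* If no eigenvector is isotropic, the self-adjoint operator [T S^-1] has no
   Jordan block (its bottom vector would be isotropic) and no eigenspace of
   dimension two (it would contain an isotropic vector). *)
Lemma pencil_diagonalization S T :
  S^T = S -> T^T = T -> S \in unitmx ->
  (forall v z, v != 0 -> v *m T = z *: (v *m S) -> v *m S *m v^T != 0) ->
  exists P (d : 'rV[K]_n.+1), [/\ P \in unitmx,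
    forall i, row i P *m T = d 0 i *: (row i P *m S),
    forall i j, i != j -> d 0 i != d 0 j,
    forall i j, i != j -> row i P *m S *m (row j P)^T = 0 &
    forall i, row i P *m S *m (row i P)^T != 0].
Proof.
move=> Ssym Tsym Su aniso; pose A := T *m invmx S.
have AS : A *m S = T by rewrite mulmxKV.
have eigT v z : v *m A = z *: v -> v *m T = z *: (v *m S).
  by move=> vA; rewrite -AS mulmxA vA scalemxAl.
have [r rE] := closed_field_poly_normal (mxminpoly A).
rewrite (monicP (mxminpoly_monic A)) scale1r in rE.
have r_uniq : uniq r.
  (* At a double root [z] let [g] be the minimal polynomial divided by X - z. A nonzero row [v] of
     g(A) is an eigenvector that also lies in the image of A - z, and self-adjointness makes it
     isotropic. *)
  apply: contraT => /not_uniq_perm[z [s rs]].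
  pose h := \prod_(x <- s) ('X - x%:P); pose g := ('X - z%:P) * h.
  have mpE : mxminpoly A = ('X - z%:P) * g.
    by rewrite rE (perm_big _ rs) /= !big_cons.
  have g0 : g != 0.
    have := monic_neq0 (mxminpoly_monic A); rewrite mpE mulf_eq0 negb_or.
    by case/andP.
  have N0 : horner_mx A g != 0.
    apply/eqP => /mxminpoly_min/(dvdp_leq g0).
    by rewrite mpE size_monicM ?monicXsubC // size_XsubC ltnn.
  have [i vi] : exists i, row i (horner_mx A g) != 0.
    apply/existsP; apply: contraNT N0 => /existsPn N0.
    by apply/eqP/row_matrixP => i; rewrite row0; apply/eqP; rewrite -[_ == _]negbK N0.
  set v := row i _ in vi; pose u := row i (horner_mx A h).
  have vE : v = u *m (A - z%:M).
    rewrite /v /g mulrC rmorphM rmorphB /= horner_mx_X horner_mx_C.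
    by rewrite -[_ * _]/(_ *m _) row_mul.
  have vA : v *m A = z *: v.
    apply/eqP; rewrite -subr_eq0 -mul_mx_scalar -mulmxBr -row_mul.
    have -> : horner_mx A g *m (A - z%:M) = 0; last by rewrite row0.
    have -> : A - z%:M = horner_mx A ('X - z%:P).
      by rewrite rmorphB /= horner_mx_X horner_mx_C.
    by rewrite -[_ *m _]/(_ * _) -rmorphM (mulrC g) -mpE; exact: mx_root_minpoly.
  have /eqP[] := aniso v z vi (eigT _ _ vA).
  have ASsym : (A - z%:M) *m S = S *m (A - z%:M)^T.
    rewrite -{2}Ssym -trmx_mul mulmxBl AS linearB /= Tsym.
    by rewrite trmx_mul tr_scalar_mx Ssym scalar_mxC.
  rewrite {1}vE -(mulmxA u) ASsym -!mulmxA -trmx_mul mulmxBr vA mul_mx_scalar subrr.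
  by rewrite trmx0 !mulmx0.
have /diagonalizableP[P Pu /diagonalizable_forPex[d /(simmxP Pu) PA]] :
    exists2 rs, uniq rs & mxminpoly A %| \prod_(x <- rs) ('X - x%:P).
  by exists r => //; rewrite -rE.
have eigP i : row i P *m T = d 0 i *: (row i P *m S).
  by apply: eigT; rewrite -row_mul PA row_mul row_diag_mx -scalemxAl -rowE.
have delta0 i : delta_mx 0 i != 0 :> 'rV[K]_n.+1.
  by apply/eqP => /rowP/(_ i); rewrite !mxE !eqxx => /eqP; rewrite oner_eq0.
have Pfree : row_free P by rewrite row_free_unit.
have aniso_row i : row i P *m S *m (row i P)^T != 0.
  by apply: aniso (eigP i); rewrite rowE mulmx_free_eq0.
have form_sym u v : v *m S *m u^T = (u *m S *m v^T)^T.
  by rewrite !trmx_mul trmxK Ssym mulmxA.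
have d_inj i j : i != j -> d 0 i != d 0 j.
  move=> ij; apply/eqP => dij.
  (* With equal eigenvalues every combination of rows [i] and [j] is an eigenvector; [y] is a root
     of the quadratic equation that makes [row i P + y *: row j P] isotropic. *)
  pose N k l := (row k P *m S *m (row l P)^T) 0 0.
  have Njj : N j j != 0.
    by apply: contraNneq (aniso_row j) => N0;
      rewrite [X in X == 0]mx11_scalar -/(N j j) N0 -scalemx1 scale0r.
  have [y yE] := @solve_monicpoly K 2
    (fun k => if k == 0%N then - (N i i / N j j) else - ((N i j + N j i) / N j j)) isT.
  rewrite big_ord_recl big_ord1 /= expr0 expr1 mulr1 in yE.
  pose v := row i P + y *: row j P.
  have v0 : v != 0.
    rewrite /v !rowE scalemxAl -mulmxDl mulmx_free_eq0 //.
    apply/eqP => /rowP/(_ i); rewrite !mxE !eqxx (negPf ij) mulr0 addr0 => /eqP.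
    by rewrite oner_eq0.
  have vT : v *m T = d 0 i *: (v *m S).
    by rewrite !mulmxDl -!scalemxAl !eigP -dij scalerDr !scalerA mulrC.
  have /eqP[] := aniso _ _ v0 vT; rewrite [LHS]mx11_scalar.
  suff -> : (v *m S *m v^T) 0 0 = 0 by rewrite -scalemx1 scale0r.
  transitivity (N i i + y * (N i j + N j i) + y ^+ 2 * N j j).
    rewrite /v linearD linearZ /= !mulmxDl !mulmxDr -!scalemxAl -!scalemxAr.
    rewrite /N; move: (_ *m _ *m (row i P)^T) (_ *m (row i P)^T) (_ *m (row j P)^T) (_
      *m _ *m (row j P)^T).
    by move=> a b c e; rewrite !mxE; ring.
  by rewrite yE; field.
exists P, d; split=> // i j ij.
(* Pairing rows [i] and [j] through [T] gives both [d 0 i] and [d 0 j] times their product under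
   [S], so distinct eigenvalues force orthogonality. *)
have := eigP i => /(congr1 (mulmx^~ (row j P)^T)); rewrite -scalemxAl.
have -> : row i P *m T *m (row j P)^T = (row j P *m T *m (row i P)^T)^T.
  by rewrite !trmx_mul trmxK Tsym mulmxA.
rewrite eigP -scalemxAl linearZ /= -form_sym => /eqP.
rewrite -subr_eq0 -scalerBl scaler_eq0 subr_eq0 (negPf (d_inj _ _ _)) /=;
  last by rewrite eq_sym.
by move/eqP.
Qed.

End Pencil.

Section NormalForm.
Variables (K : closedFieldType) (charK0 : [pchar K] =i pred0).

(** Smoothness of the quadric makes its Hessian invertible. Smoothness of the curve forbids
    proportional gradients at its points, so no eigenvector is isotropic and the pencil can be
    diagonalized. *)
Lemma pencil_normal_form (q q' : {mpoly K[4]}) :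
  q \is 2.-homog -> q' \is 2.-homog ->
  smooth_complete_intersection [tuple q] ->
  smooth_complete_intersection [tuple q; q'] ->
  exists (M : 'M[K]_4) (al be ga de : K),
    [/\ M \in unitmx,
      [/\ al != 0, be != 0, ga != 0, de != 0 & al * de - be * ga != 0] &
      forall v : 'rV[K]_4, (q.@[(v *m M) 0] = 0 /\ q'.@[(v *m M) 0] = 0) <->
                ((q1 al be).@[v 0] = 0 /\ (q2 ga de).@[v 0] = 0)].
Proof.
move=> /hessian[S [Ssym gradS qS]] /hessian[T [Tsym gradT qT]] Q_smooth B_smooth.
have two0 : 2%:R != 0 :> K by move/pcharf0P: charK0 => ->.
have q0 (v : 'rV[K]_4) : q.@[v 0] = 0 <-> (v *m S *m v^T) 0 0 = 0.
  by rewrite -qS; split=> [->|/eqP]; rewrite ?mulr0 // mulf_eq0 (negPf two0) => /eqP.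
have q'0 (v : 'rV[K]_4) : q'.@[v 0] = 0 <-> (v *m T *m v^T) 0 0 = 0.
  by rewrite -qT; split=> [->|/eqP]; rewrite ?mulr0 // mulf_eq0 (negPf two0) => /eqP.
have Su : S \in unitmx.
  rewrite -row_free_unit -kermx_eq0; apply/eqP; apply: contraTeq isT => /rowV0Pn.
  move=> [v /sub_kermxP vS v0].
  have /Q_smooth : on_locus [tuple q] v.
    by split=> // i; rewrite (ord1 i); apply/q0; rewrite vS mul0mx mxE.
  suff -> : jacobian [tuple q] v = 0 by rewrite /row_free mxrank0.
  by apply/matrixP => i j; rewrite mxE (ord1 i) gradS vS !mxE.
have aniso (v : 'rV[K]_4) z : v != 0 -> v *m T = z *: (v *m S) -> v *m S *m v^T != 0.
  move=> v0 vT; apply/eqP => vSv.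
  have /B_smooth : on_locus [tuple q; q'] v.
    split=> // -[[|[|//]] i2]; first by apply/q0; rewrite vSv mxE.
    by apply/q'0; rewrite vT -scalemxAl vSv scaler0 mxE.
  pose w : 'rV[K]_2 := \row_i (if i == 0 then z else -1).
  move=> J_free; have : w *m jacobian [tuple q; q'] v = 0.
    apply/rowP => j; rewrite mxE !big_ord_recl big_ord0 !mxE /= gradS gradT vT addr0.
    by rewrite [X in - 1 * X]mxE mulN1r subrr.
  move/eqP; rewrite mulmx_free_eq0 // => /eqP/rowP/(_ 1); rewrite !mxE /= => /eqP.
  by rewrite oppr_eq0 oner_eq0.
have [P [d [Pu eigP d_inj Porth Pdiag]]] := pencil_diagonalization Ssym Tsym Su aniso.
pose s i := (row i P *m S *m (row i P)^T) 0 0.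
have s0 i : s i != 0.
  by apply: contraNneq (Pdiag i) => s0;
    rewrite [X in X == 0]mx11_scalar -/(s i) s0 -scalemx1 scale0r.
have PSP : P *m S *m P^T = diag_mx (\row_i s i).
  apply/matrixP => i j; rewrite !mxE.
  have -> : \sum_k (P *m S) i k * P^T k j = (row i P *m S *m (row j P)^T) 0 0.
    by rewrite -row_mul !mxE; apply: eq_bigr => k _; rewrite !mxE.
  by have [<-|/Porth ->] := eqVneq i j; rewrite ?mulr1n // mxE mulr0n.
have PT : P *m T = diag_mx d *m (P *m S).
  apply/row_matrixP => i; rewrite row_mul eigP [RHS]row_mul row_diag_mx.
  by rewrite -scalemxAl -rowE row_mul.
have form_diag (e : 'rV[K]_4) (v : 'rV[K]_4) :
    (v *m diag_mx e *m v^T) 0 0 = \sum_i e 0 i * v 0 i ^+ 2.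
  rewrite mxE; apply: eq_bigr => i _; rewrite mul_mx_diag !mxE; ring.
have qP (v : 'rV[K]_4) : (v *m P *m S *m (v *m P)^T) 0 0 = \sum_i s i * v 0 i ^+ 2.
  rewrite trmx_mul -!mulmxA (mulmxA P) (mulmxA _ P^T) PSP mulmxA form_diag.
  by apply: eq_bigr => i _; rewrite mxE.
have q'P (v : 'rV[K]_4) : (v *m P *m T *m (v *m P)^T) 0 0 = \sum_i d 0 i * s i * v 0 i ^+ 2.
  rewrite trmx_mul -!mulmxA (mulmxA P) PT -mulmxA (mulmxA _ P^T) PSP.
  rewrite !mulmxA -(mulmxA v) mulmx_diag form_diag.
  by apply: eq_bigr => i _; rewrite !mxE.
have sum4 (f : 'I_4 -> K) : \sum_i f i = f o0 + f o1 + f o2 + f o3.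
  rewrite !big_ord_recl big_ord0 addr0 !addrA.
  by congr (f _ + f _ + f _ + f _); apply: val_inj.
have dd i j : i != j -> d 0 i - d 0 j != 0 by move=> /d_inj; rewrite subr_eq0.
(* Up to nonzero scalars, [q1] is q' - d_3 q, where the square of x3 cancels, and [q2] is q' - d_2
   q, where that of x2 cancels. *)
exists P, (- ((d 0 o0 - d 0 o3) * s o0) / ((d 0 o2 - d 0 o3) * s o2)),
  (- ((d 0 o1 - d 0 o3) * s o1) / ((d 0 o2 - d 0 o3) * s o2)),
  ((d 0 o0 - d 0 o2) * s o0 / ((d 0 o2 - d 0 o3) * s o3)),
  ((d 0 o1 - d 0 o2) * s o1 / ((d 0 o2 - d 0 o3) * s o3)).
have d23 := dd o2 o3 isT; have s2 := s0 o2; have s3 := s0 o3.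
split=> //.
  split; rewrite ?mulf_neq0 ?invr_eq0 ?oppr_eq0 ?mulf_neq0 ?dd //.
  rewrite (_ : _ - _ = (d 0 o0 - d 0 o1) * s o0 * s o1
      / ((d 0 o2 - d 0 o3) * s o2 * s o3)).
    by rewrite !mulf_neq0 ?invr_eq0 ?mulf_neq0 ?dd.
  by field; rewrite d23 s2 s3.
move=> v; rewrite q0 q'0 qP q'P !sum4 meval_q1 meval_q2.
set F := _ + _; set G := _ + _ + _ + _.
set R := v 0 o2 ^+ 2 - _; set R' := v 0 o3 ^+ 2 - _.
have E1 : G - d 0 o3 * F = (d 0 o2 - d 0 o3) * s o2 * R.
  by rewrite /G /F /R; field; rewrite d23 s2.
have E2 : G - d 0 o2 * F = - ((d 0 o2 - d 0 o3) * s o3 * R').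
  by rewrite /G /F /R'; field; rewrite d23 s3.
split=> [[F0 G0]|[R0 R'0]].
  split; apply/eqP.
    have /eqP := E1; rewrite F0 G0 mulr0 subr0 eq_sym mulf_eq0 orbC.
    by case/orP=> //; rewrite mulf_eq0 (negPf d23) (negPf s2).
  have /eqP := E2; rewrite F0 G0 mulr0 subr0 eq_sym oppr_eq0 mulf_eq0 orbC.
  by case/orP=> //; rewrite mulf_eq0 (negPf d23) (negPf s3).
have F0 : F = 0.
  apply/eqP; have : (d 0 o2 - d 0 o3) * F = 0.
    transitivity ((G - d 0 o3 * F) - (G - d 0 o2 * F)); first by ring.
    by rewrite E1 E2 R0 R'0 !mulr0 oppr0 subr0.
  by move/eqP; rewrite mulf_eq0 (negPf d23).
by split=> //; move: E1; rewrite F0 R0 !mulr0 subr0.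
Qed.

End NormalForm.

(** * The general linear system *)

Section Main.
Variable K : closedFieldType.
Local Notation A := {mpoly K[4]}.

Lemma big_mxvec_index r (f : 'I_(r * 4) -> nat) :
  (\sum_k f k = \sum_i \sum_l f (mxvec_index i l))%N.
Proof.
rewrite pair_bigA (reindex (uncurry (@mxvec_index r 4))) /=; last exact: curry_mxvec_bij.
by apply: eq_bigr => -[].
Qed.

(** Freezing all points but the j-th turns an open condition on r points into a form in one point,
    as [general_points] requires. *)
Lemma multihomogeneous_row r (G : {mpoly K[r * 4]}) (M : 'M[K]_4) (P : 'M[K]_(r, 4)) j :
  multihomogeneous G -> exists d (F : A), F \is d.-homog /\
    forall x, meval_pts G (setrow P j x *m M) = F.@[x 0].
Proof.
move=> [e Ge].
pose N : 'M[A]_(r, 4) := \matrix_(i, l)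
  if i == j then \sum_s M s l *: 'X_s else ((P *m M) i l)%:MP.
pose T := [tuple mxvec N 0 k | k < r * 4].
exists (e j), (G \mPo T); split=> [|x]; last first.
  rewrite comp_mpoly_meval; apply: meval_eq => k; rewrite tnth_mktuple.
  case/mxvec_indexP: k => i l; rewrite !mxvecE [in RHS]mxE [RHS]fun_if mevalC raddf_sum mxE.
  case: eqP => [->|/eqP ij].
    by apply: eq_bigr => s _; rewrite /= mevalZ mevalXU !mxE eqxx mulrC.
  by rewrite mxE; apply: eq_bigr => s _; rewrite mxE (negPf ij).
rewrite comp_mpolyEX big_seq; apply: rpred_sum => mu muG; apply: dhomogZ.
rewrite comp_mpolyX -(Ge _ muG j).
pose w : 'rV[nat]_(r * 4) := mxvec (\matrix_(i, l) nat_of_bool (i == j)).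
have -> : (\sum_l mu (mxvec_index j l) = \sum_k w 0%R k * mu k)%N.
  rewrite big_mxvec_index (bigD1 j) //= [X in (_ + X)%N]big1 ?addn0 => [|i /negPf ij].
    by apply: eq_bigr => l _; rewrite mxvecE mxE eqxx mul1n.
  by rewrite big1 // => l _; rewrite mxvecE mxE ij.
apply: dhomog_prodr => k _; apply: dhomogMn; rewrite tnth_mktuple.
case/mxvec_indexP: k => i l; rewrite !mxvecE !mxE; case: eqP => _ /=.
  by apply: rpred_sum => s _; apply/dhomogZ/dhomogXU.
by rewrite -[_%:MP]mulr1 mul_mpolyC; apply/dhomogZ/dhomog1.
Qed.

(** On the line X0 = X1 = 0, at X3 = 1, the form [q2] is 1 and [q1] takes every value, which leaves
    a polynomial in one variable that vanishes identically. *)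
Lemma quadric_monomials_free (al be ga de : K) m (c : 'I_m.+1 -> K) :
  \sum_a c a *: (q1 al be ^+ a * q2 ga de ^+ (m - a)) = 0 :> A -> forall a, c a = 0.
Proof.
move=> c0; pose p := \sum_(a < m.+1) c a *: 'X^a : {poly K}.
suff p0 : p = 0.
  move=> a; have := congr1 (fun p : {poly K} => p`_a) p0.
  rewrite /p coef_sum (bigD1 a) //= coefZ coefXn eqxx mulr1 coef0 big1 ?addr0 // => b ba.
  by rewrite coefZ coefXn (_ : (a == b :> nat) = false) ?mulr0 // eq_sym; apply/negbTE.
apply: poly_eq0_horner => x; have [u uE] := closed_sqrt x.
pose v : 'I_4 -> K := fun i => nth 0 [:: 0; 0; u; 1] i.
have := congr1 (meval v) c0; rewrite meval0 raddf_sum => <-.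
rewrite horner_sum; apply: eq_bigr => a _ /=.
rewrite mevalZ mevalM !rmorphXn /= meval_q1 meval_q2 /v /= !expr0n /= !mulr0 !addr0.
by rewrite !subr0 expr1n expr1n mulr1 uE hornerZ hornerXn.
Qed.

End Main.

Theorem theorem6p1 (K : closedFieldType) (charK0 : [pchar K] =i pred0)
    (q q' : {mpoly K[4]})
    (q_quadric : q \is 2.-homog) (q'_quadric : q' \is 2.-homog)
    (Q_smooth : smooth_complete_intersection [tuple q])
    (B_smooth : smooth_complete_intersection [tuple q; q'])
    (r m : nat) (r_ge8 : (8 <= r)%N) :
  in_general_position (on_locus [tuple q; q'])
    (fun P : 'M[K]_(r, 4) =>
       pdim (linear_system (2 * m) (fun _ : 'I_r => m) P) = m%:Z).
Proof.
have [M [al [be [ga [de [Mu [al0 be0 ga0 de0 disc0] qM]]]]]] :=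
  pencil_normal_form charK0 q_quadric q'_quadric Q_smooth B_smooth.
pose L (P : 'M[K]_(r, 4)) := linear_system (2 * m) (fun _ : 'I_r => m) P.
pose Xr (P : 'M[K]_(r, 4)) := forall i, row i P != 0 /\ on_locus [tuple q; q'] (row i P).
have locusP v : (vanishes_at [tuple q; q'] v) <-> (q.@[v 0] = 0 /\ q'.@[v 0] = 0).
  split=> [v0|[v0 v1] [[|[|//]] i2]] //.
  by split; [apply: (v0 0) | apply: (v0 1)].
pose Q1 := lin_subst (invmx M) (q1 al be); pose Q2 := lin_subst (invmx M) (q2 ga de).
have q1_homog : q1 al be \is 2.-homog.
  by rewrite /q1 rpredB ?rpredD ?rpredZ ?dhomogXn.
have q2_homog : q2 ga de \is 2.-homog.
  by rewrite /q2 rpredB ?rpredD ?rpredZ ?dhomogXn.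
have lin_substK F : lin_subst (invmx M) (lin_subst M F) = F by rewrite lin_subst_mul
  mulVmx // lin_subst1.
have lin_substVK F : lin_subst M (lin_subst (invmx M) F) = F by rewrite lin_subst_mul
  mulmxV // lin_subst1.
have mon_homog (a : 'I_m.+1) : Q1 ^+ a * Q2 ^+ (m - a) \is (2 * m).-homog.
  have -> : (2 * m = 2 * a + 2 * (m - a))%N by have := ltn_ord a; lia.
  by apply: dhomogM; apply: dhomogMn; apply: dhomog_lin_subst.
pose mon a : dhomog 4 K (2 * m) := DHomog (mon_homog a).
pose W := <<[tuple mon a | a < m.+1]>>%VS.
have dimW : \dim W = m.+1.
  suff /eqP -> : free [tuple mon a | a < m.+1] by rewrite size_tuple.
  apply/freeP => c c0; apply: (@quadric_monomials_free _ al be ga de).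
  have := congr1 (fun F : dhomog 4 K (2 * m) => lin_subst M F) c0.
  rewrite /= raddf_sum lin_subst_sum /= [RHS](comp_mpoly0 _) => lc0; rewrite -[RHS]lc0.
  apply: eq_bigr => a _; rewrite lin_substZ (nth_map a) ?size_enum_ord // nth_ord_enum /=.
  by rewrite lin_substM !lin_substXn !lin_substVK.
have WL P : Xr P -> (W <= L P)%VS.
  move=> PX; apply/span_subvP => F /tnthP[a ->]; rewrite tnth_mktuple.
  apply/linear_systemP => i /=; have [_ [_ /locusP qP]] := PX i.
  have [] : Q1.@[row i P 0] = 0 /\ Q2.@[row i P 0] = 0.
    by rewrite !meval_lin_subst; apply/qM; rewrite mulmxKV.
  move=> /(@mult_ge_exp _ _ _ _ a) m1 /(@mult_ge_exp _ _ _ _ (m - a)) m2.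
  by have := mult_geM m1 m2; rewrite subnKC // -ltnS.
(* The open set is the union of the loci G != 0 over all multihomogeneous [G] that force dimension
   at most m + 1 on the curve. Openness is then immediate, and density asks for one such [G] at some
   point of each [V]. *)
exists (fun P => exists2 G, [/\ multihomogeneous G &
    forall P', Xr P' -> meval_pts G P' != 0 -> (\dim (L P') <= m.+1)%N] &
  meval_pts G P != 0); split.
- exists (fun G => multihomogeneous G /\
    forall P', Xr P' -> meval_pts G P' != 0 -> (\dim (L P') <= m.+1)%N) => [G []//|P _].
  by split=> -[G [? ?] ?]; exists G.
- move=> V [S Shom SV] [P0 P0X VP0].
  have [G SG GP0] := (SV P0 (fun i => (P0X i).1)).1 VP0.
  (* The general points are chosen in diagonal coordinates, inside the nonempty open part of [V]
     given by [G]. *)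
  have [|||P' [GP' P'chart P'gen]] := @general_points K charK0 al be ga de al0 be0 ga0 de0
    disc0 r m (fun P => meval_pts G (P *m M)) (P0 *m invmx M) r_ge8.
  + by move=> P j; apply: multihomogeneous_row; apply: Shom.
  + move=> i; rewrite row_mul; apply/qM; rewrite mulmxKV //; apply/locusP.
    by have [_ []] := P0X i.
  + by rewrite mulmxKV.
  pose P := P' *m M.
  have PX : Xr P.
    move=> i; have [t [u [w [tC _ EP]]]] := P'chart i.
    have Pi0 : row i P != 0.
      rewrite /P row_mul mulmx_free_eq0 ?row_free_unit // EP.
      by apply/eqP => /rowP/(_ o0); rewrite curve_ptE mxE => /eqP; rewrite oner_eq0.
    split=> //; split=> //; apply/locusP; rewrite /P row_mul; apply/qM.
    by rewrite EP; apply: on_curve_q.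
  have LW : (L P <= W)%VS.
    apply/subvP => F /linear_systemP FP.
    have [c Fc] := mult_ge_qcomb charK0 al0 be0 ga0 de0 disc0 P'chart P'gen
      (dhomog_lin_subst M (dhomog_is_dhomog F)) (fun i => mult_ge_lin_subst
        (eq_ind _ (fun v => mult_ge v m F) (FP i) _ (row_mul i P' M))).
    suff -> : F = \sum_(a < m.+1) c a *: mon a.
      apply: memv_suml => a _; apply: memvZ; apply: memv_span.
      by apply/tnthP; exists a; rewrite tnth_mktuple.
    apply: val_inj; rewrite /= -[LHS]lin_substK Fc lin_subst_sum raddf_sum;
      apply: eq_bigr => a _.
    by rewrite lin_substZ lin_substM !lin_substXn.
  have dimL : (\dim (L P) <= m.+1)%N by rewrite -dimW dimvS.
  (* Semicontinuity spreads the bound from [P] to the locus where [H] is nonzero. *)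
  have [H [Hhom HP Hdim]] := linear_system_semicontinuous charK0 (2 * m) m P.
  exists P; split=> //; last by apply/SV => [i|]; [case: (PX i) | exists G].
  exists H; last exact: HP.
  split=> [|P1 _ HP1]; [exact: Hhom | exact: leq_trans (Hdim _ HP1) dimL].
move=> P PX [G [_ Gdim] GP]; rewrite /pdim.
suff -> : \dim (L P) = m.+1 by rewrite -addn1 PoszD addrK.
by apply/eqP; rewrite eqn_leq Gdim // -dimW dimvS // WL.
Qed.
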